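(* Let $K\subset\mathbb{C}^r$ be equal to a product $K=K_1\times K_2$ of compact subsets of $\mathbb{C}^k\times\mathbb{C}^{r-k}$ (that is, $K_1\subset\mathbb{C}^k$ and $K_2\subset\mathbb{C}^{r-k}$ are compact), where $k\ge 0$. Let $\underline{w}=(w_1,\ldots,w_r)$ be a vector of positive rational numbers, and write $\underline{w}=(\underline{w}',\underline{w}'')$ where $\underline{w}'=(w_1,\ldots,w_k)$ and $\underline{w}''=(w_{k+1},\ldots,w_r)$. If the limits (defining $t_{\underline{w}}(K)$, $t_{\underline{w}'}(K_1)$, $t_{\underline{w}''}(K_2)$) exist, then $$t_{\underline{w}}(K)=t_{\underline{w}'}(K_1)^{|\underline{w}'|/|\underline{w}|}\times t_{\underline{w}''}(K_2)^{|\underline{w}''|/|\underline{w}|},$$ where $|\underline{w}|=w_1+\cdots+w_r$ and similarly for $|\underline{w}'|$, $|\underline{w}''|$. In particular, $$t_r(K)=t_k(K_1)^{k/r}\times t_{r-k}(K_2)^{(r-k)/r}.$$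
   Context: For integers $N_1,\ldots,N_s\ge 2$ with product $M=N_1\cdots N_s$, let $(e_1,\ldots,e_M)$ be the monomials in $s$ variables $z^{(1)},\ldots,z^{(s)}$ which are of degree $\le N_t-1$ in each $z^{(t)}$, ordered degree-lexicographically (first by total degree, then within each degree by the lexicographic order). For vectors $\underline{z}_1,\ldots,\underline{z}_M\in\mathbb{C}^s$, $V_{(N_1,\ldots,N_s)}(\underline{z}_1,\ldots,\underline{z}_M)$ is the $M\times M$ matrix with $(i,j)$ entry $e_j(\underline{z}_i)$. For a compact subset $L\subset\mathbb{C}^s$, the transfinite diameter is $$t_s(L)=\lim_{N\to\infty}\ \sup_{\underline{z}_1,\ldots,\underline{z}_{N^s}\in L}\bigl|\det V_{(N,\ldots,N)}(\underline{z}_1,\ldots,\underline{z}_{N^s})\bigr|^{1/D_N},$$ where $D_N=\frac{s}{2}N^s(N-1)$ is the total degree of the determinant (the existence of this limit may be established following Zaharjuta). For a vector $\underline{u}=(u_1,\ldots,u_s)$ of positive rational numbers, define, if the limit exists, $$t_{\underline{u}}(L)=\lim_{N\to\infty}\ \sup_{\underline{z}_1,\ldots,\underline{z}_\ell\in L}\bigl|\det V_{(u_1N,\ldots,u_sN)}(\underline{z}_1,\ldots,\underline{z}_\ell)\bigr|^{1/D_{\underline{u}N}},$$ where $\ell=u_1\cdots u_sN^s$, $D_{\underline{u}N}$ is the total degree of the determinant, and the limit is taken over all $N$ divisible by the common denominator of $u_1,\ldots,u_s$, so that all $u_iN$ are integers. When $\underline{u}=(1,\ldots,1)$ this reduces to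 $t_s(L)$. *)

(* Defs.v *)
From HB Require Import structures.
From mathcomp Require Import all_boot all_order all_algebra.
From mathcomp Require Import complex.
(* The notations of mpoly clash with those of MathComp-Analysis. *)
From mathcomp Require Import -(notations) mpoly.
From mathcomp Require Import all_classical all_reals all_analysis.

Set Implicit Arguments.
Unset Strict Implicit.
Unset Printing Implicit Defensive.

Import Order.TTheory GRing.Theory Num.Theory.
Import numFieldNormedType.Exports.

Local Open Scope classical_set_scope.
Local Open Scope ring_scope.

(* The declared type makes the generic topology of a numClosedFieldType, given
   by the modulus, available on the complex numbers and on ['rV[Cplx R]_s]. *)
Definition Cplx (R : realType) : numClosedFieldType := complex R.

(* The order [<=%O] on [multinom s] is the degree-lexicographic one: it compares
   the sequences [mdeg m :: m] lexicographically. *)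
Definition box_monomials (s : nat) (N : 'I_s -> nat) : seq (multinom s) :=
  sort <=%O
    [seq Multinom [tuple nat_of_ord (f t) | t < s]
       | f : {dffun forall t : 'I_s, 'I_(N t)}].

Definition box_size (s : nat) (N : 'I_s -> nat) : nat := (\prod_(t < s) N t)%N.

Lemma size_box_monomials (s : nat) (N : 'I_s -> nat) :
  size (box_monomials N) = box_size N.
Proof.
rewrite size_sort size_map -cardE card_dep_ffun foldrE big_map big_enum /=.
by apply: eq_bigr => t _; rewrite card_ord.
Qed.

(* The coefficients range over an arbitrary ring, so that the same matrix can be
   evaluated at complex points and at the generic point. *)
Definition vandermonde (A : comNzRingType) (s : nat) (N : 'I_s -> nat)
    (z : 'M[A]_(box_size N, s)) : 'M[A]_(box_size N) :=
  \matrix_(i, j) \prod_(t < s) z i t ^+ (nth (@mnm0 s) (box_monomials N) j) t.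

(* The entries of this matrix are pairwise distinct indeterminates. *)
Definition generic_points (R : realType) (s : nat) (N : 'I_s -> nat) :
    'M[mpoly (box_size N * s) (Cplx R)]_(box_size N, s) :=
  \matrix_(i, t) mpolyX (Cplx R) (mnm1 (mxvec_index i t)).

(* [mmeasure mdeg p] is one more than the total degree of [p] for nonzero [p]. *)
Definition det_degree (R : realType) (s : nat) (N : 'I_s -> nat) : nat :=
  (mmeasure mdeg (\det (vandermonde (generic_points R N)))).-1.

Definition sup_vandermonde (R : realType) (s : nat) (L : set 'rV[Cplx R]_s)
    (N : 'I_s -> nat) (D : R) : R :=
  sup [set Normc.normc (\det (vandermonde z)) `^ D^-1
         | z in [set z : 'M[Cplx R]_(box_size N, s) | forall i, L (row i z)]].

Definition tdiam_seq (R : realType) (s : nat) (L : set 'rV[Cplx R]_s)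
    (N : nat) : R :=
  sup_vandermonde L (fun _ : 'I_s => N)
    (s%:R / 2 * N%:R ^+ s * (N%:R - 1)).

Definition tdiam (R : realType) (s : nat) (L : set 'rV[Cplx R]_s) : R :=
  lim (tdiam_seq L N @[N --> \oo]).

Definition common_den (s : nat) (u : 'rV[rat]_s) : nat :=
  (\big[lcmn/1]_(t < s) `|denq (u 0%R t)|)%N.

(* For [u] positive and [common_den u %| N], each [u 0 t * N%:R] is a natural
   number and [Num.truncn] merely changes its type. *)
Definition wbox (s : nat) (u : 'rV[rat]_s) (N : nat) (t : 'I_s) : nat :=
  Num.truncn (u 0 t * N%:R).

Definition wtdiam_seq (R : realType) (s : nat) (u : 'rV[rat]_s)
    (L : set 'rV[Cplx R]_s) (N : nat) : R :=
  sup_vandermonde L (wbox u N) (det_degree R (wbox u N))%:R.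

Definition wtdiam_filter (s : nat) (u : 'rV[rat]_s) : set_system nat :=
  within [set N | (common_den u %| N)%N] \oo.

Definition wtdiam_exists (R : realType) (s : nat) (u : 'rV[rat]_s)
    (L : set 'rV[Cplx R]_s) : Prop :=
  cvg (wtdiam_seq u L N @[N --> wtdiam_filter u]).

Definition wtdiam (R : realType) (s : nat) (u : 'rV[rat]_s)
    (L : set 'rV[Cplx R]_s) : R :=
  lim (wtdiam_seq u L N @[N --> wtdiam_filter u]).

Definition weight (s : nat) (u : 'rV[rat]_s) : rat := \sum_(t < s) u 0 t.

Definition prod_set (R : realType) (k l : nat) (K1 : set 'rV[Cplx R]_k)
    (K2 : set 'rV[Cplx R]_l) : set 'rV[Cplx R]_(k + l) :=
  [set z | K1 (lsubmx z) /\ K2 (rsubmx z)].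

(* Main.v *)
Require Import Defs.
From mathcomp Require Import all_boot all_order all_algebra all_fingroup.
From mathcomp Require Import complex mxtens zify ring lra.
From mathcomp Require Import -(notations) mpoly.
From mathcomp Require Import all_classical all_reals all_analysis.

(** Write v(L, N) for the supremum of |det V_N| over tuples of points of L, M for
the number of monomials and D for the degree of the determinant.  Everything rests
on one estimate ([newton_basis]): choosing interpolation points greedily and
subtracting interpolants (Newton's form) turns the monomials, by a unitriangular
change of basis, into polynomials whose sup norms b_j on L satisfy
prod b_j <= 2^M v.  Conversely a determinant is at most M! times the product of the
sup norms of its columns, so v(L, N) is the product of the norms of an optimal
unitriangular basis up to a factor 2^M M!, which is harmless because
log M! = o(D).

For a product K1 x K2 the monomials are the products of those of the two factors.
Points of the form (x_i, y_j) give a Kronecker product, hence the lower bound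
v1^M2 v2^M1 <= v ([vmax_prod_ge_sup]); the products of the two Newton bases give the
upper bound v <= M! 4^M v1^M2 v2^M1 ([vmax_prod_le]).  The degree of the
determinant is M * sum (N_t - 1) / 2 ([det_degreeE]), so taking D-th roots leaves the
exponents sum' (N_t - 1) / sum (N_t - 1), which tend to |w'|/|w| and |w''|/|w|, while
(M! 4^M)^(1/D) tends to 1.  This yields [cdiam_prod_cvg], and with it the formula
whenever the diameters of the two factors are limits.

The formula for t_r also needs that the limits defining t_k(K1), t_(r-k)(K2) and
t_r(K) exist ([tdiam_seq_cvg]), which is a Fekete argument.  Let p_g be the Newton
basis of the cube of side m, monic with leading monomial g for the
degree-lexicographic order.  In the cube of side N = q m every exponent is uniquely
q g + r with r in the cube of side q, and p_g^q z^r is monic with that leading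
monomial and stays in the cube.  Comparing norms gives
v_N <= (N^s)! v_m^(q^(s+1)) E^(q^(s+1) m^s) with E = 2 c^s if the coordinates of L are
bounded by c >= 1, plus a correction when m does not divide N ([vmax_cube_growth]).
Hence the roots x_N = v_N^(1/D) satisfy limsup x_N <= x_m^((m-1)/m) E^(2/(s m))
for every m, and letting m grow forces convergence ([cvg_of_limsup_bounds]). *)

Set Implicit Arguments.
Unset Strict Implicit.
Unset Printing Implicit Defensive.

Import Order.TTheory GRing.Theory Num.Theory.
Import numFieldNormedType.Exports.

Local Open Scope classical_set_scope.
Local Open Scope ring_scope.

Local Notation normc := Normc.normc.

(** * The modulus of a determinant *)

Section Modulus.
Variable R : realType.
Implicit Types x y : Cplx R.

Lemma modulus_ge0 x : 0 <= normc x.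
Proof. by case: x => a b; exact: sqrtr_ge0. Qed.

Lemma modulus0 : normc (0 : Cplx R) = 0.
Proof. exact: Normc.normc0. Qed.

Lemma modulus1 : normc (1 : Cplx R) = 1.
Proof. exact: Normc.normc1. Qed.

Lemma modulusM x y : normc (x * y) = normc x * normc y.
Proof. exact: Normc.normcM. Qed.

Lemma modulusD x y : normc (x + y) <= normc x + normc y.
Proof. exact: le_normcD. Qed.

Lemma modulus_eq0 x : (normc x == 0) = (x == 0).
Proof.
by apply/eqP/eqP => [/Normc.eq0_normc //|->]; exact: modulus0.
Qed.

Lemma modulus_sign n : normc ((-1) ^+ n : Cplx R) = 1.
Proof.
elim: n => [|n IH]; first by rewrite expr0 modulus1.
have e : normc (-1 : Cplx R) = normc (1 : Cplx R) by exact: (@normcN R 1).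
by rewrite exprS modulusM IH e modulus1 mulr1.
Qed.

Lemma modulusX x n : normc (x ^+ n) = normc x ^+ n.
Proof.
by elim: n => [|n IH]; rewrite ?expr0 ?modulus1 // !exprS modulusM IH.
Qed.

Lemma modulus_prod I (r : seq I) (P : pred I) (F : I -> Cplx R) :
  normc (\prod_(i <- r | P i) F i) = \prod_(i <- r | P i) normc (F i).
Proof. exact: (big_morph _ modulusM modulus1). Qed.

Lemma modulus_sum I (r : seq I) (P : pred I) (F : I -> Cplx R) :
  normc (\sum_(i <- r | P i) F i) <= \sum_(i <- r | P i) normc (F i).
Proof.
elim/big_rec2: _ => [|i y z _ IH]; first by rewrite modulus0.
by apply: le_trans (modulusD _ _) _; rewrite lerD2l.
Qed.

(** Cruder than Hadamard's inequality, but the loss of a factorial disappears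
after taking roots of order the degree. *)
Lemma modulus_det_le n (A : 'M[Cplx R]_n) (b : 'I_n -> R) :
    (forall i j, normc (A i j) <= b j) ->
  normc (\det A) <= n`!%:R * \prod_j b j.
Proof.
move=> Ab; apply: le_trans (modulus_sum _ _ _) _.
have -> : n`!%:R * \prod_j b j = \sum_(s : 'S_n) \prod_j b j.
  by rewrite sumr_const card_Sn mulr_natl.
apply: ler_sum => s _; rewrite modulusM modulus_sign mul1r modulus_prod.
rewrite [leRHS](reindex_inj (@perm_inj _ s)) /=.
by apply: ler_prod => i _; rewrite modulus_ge0 Ab.
Qed.

End Modulus.

(** * Newton bases *)

Section NewtonBasis.
Variables (R : realType) (X : Type) (L : set X).

(** The supremum need not be attained on [L]; losing a factor 2 replaces an
extremal point and costs only a factor 2^M in the determinant. *)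
Lemma near_sup_point (f : X -> R) :
    (forall x, 0 <= f x) -> (exists b : R, forall x, L x -> f x <= b) ->
    (exists2 x, L x & f x != 0) ->
  exists2 z, L z & 0 < f z /\ forall x, L x -> f x <= 2 * f z.
Proof.
move=> f0 [b fb] [y Ly fy]; set E := f @` L.
have supE : has_sup E.
  by split; [exists (f y), y | exists b => _ [x Lx <-]; exact: fb].
have fE x : L x -> f x <= sup E by move=> Lx; apply: sup_upper_bound => //; exists x.
have s0 : 0 < sup E by apply: lt_le_trans (fE _ Ly); rewrite lt_def fy f0.
have s20 : 0 < sup E / 2 by rewrite divr_gt0.
have [_ [z Lz <-]] := sup_adherent s20 supE.
have -> : sup E - sup E / 2 = sup E / 2 by rewrite {1}(splitr (sup E)) addrK.
move=> fz; exists z => //; split; first exact: lt_trans fz.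
move=> x /fE fx; apply: le_trans fx _.
by rewrite mulrC -ler_pdivrMr // ltW.
Qed.

(** Gaussian elimination with greedy pivots: the first pivot is a point [z] where
[phi 0] is at least half its supremum, and subtracting multiples of [phi 0] makes
the other functions vanish at [z].  The determinant at [z] and further points is
then the pivot times the determinant of the reduced family, so the bound [V] is
divided by the pivot at each step.  A degenerate family is no obstacle: as soon as
a function to be used as pivot vanishes on [L], its bound 0 makes the product zero. *)
Lemma newton_basis M (phi : 'I_M -> X -> Cplx R) (V : R) :
    (forall j, exists b : R, forall x, L x -> normc (phi j x) <= b) -> 0 <= V ->
    (forall x : 'I_M -> X, (forall i, L (x i)) ->
       normc (\det (\matrix_(i, j) phi j (x i))) <= V) ->
  exists (U : 'M[Cplx R]_M) (b : 'I_M -> R),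
    [/\ forall i, U i i = 1, forall i j : 'I_M, (j < i)%N -> U i j = 0,
        forall j, 0 <= b j,
        forall j x, L x -> normc (\sum_i phi i x * U i j) <= b j
      & \prod_j b j <= 2 ^+ M * V].
Proof.
elim: M phi V => [|M IH]; last rewrite -[M.+1]/(1 + M)%N; move=> phi V phib V0 detV.
  exists 1%:M, (fun=> 0); split; do ?by case.
  rewrite big_ord0 expr0 mul1r.
  have x0 : 'I_0 -> X by case.
  have := detV x0 (fun i : 'I_0 => match i with Ordinal _ h => False_ind _ (notF h) end).
  by rewrite det_mx00 modulus1.
have [phi0|] := pselect (forall x, L x -> phi ord0 x = 0).
  have [b bP] := choice phib.
  exists 1%:M, (fun j => if j == ord0 then 0 else Num.max 0 (b j)); split.
  - by move=> i; rewrite mxE eqxx.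
  - by move=> i j ji; rewrite mxE -val_eqE gtn_eqF.
  - by move=> j; case: ifP => // _; rewrite le_max lexx.
  - move=> j x Lx; rewrite (bigD1 j) //= big1 ?addr0.
      rewrite mxE eqxx mulr1; case: eqP => [->|_].
        by rewrite phi0 // modulus0.
      by rewrite le_max bP // orbT.
    by move=> i ij; rewrite mxE (negbTE ij) mulr0.
  - by rewrite (bigD1 ord0) //= mul0r mulr_ge0 // exprn_ge0.
move=> /existsNP[y /not_implyP[Ly /eqP phiy]].
have [|||z Lz [phiz0 phiz]] := @near_sup_point (fun x => normc (phi ord0 x)).
- by move=> x; exact: modulus_ge0.
- exact: phib.
- by exists y; rewrite // modulus_eq0.
have a0 : phi ord0 z != 0 by rewrite -modulus_eq0 gt_eqF.
(* The multipliers of the elimination step at the pivot [z]. *)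
pose c : 'rV_M := \row_j (phi (lift ord0 j) z / phi ord0 z).
pose psi (j : 'I_M) x := phi (lift ord0 j) x - phi ord0 x * c 0 j.
have psib j : exists b : R, forall x, L x -> normc (psi j x) <= b.
  have [[b bP] [b' bP']] := (phib (lift ord0 j), phib ord0).
  exists (b + b' * normc (- c 0 j)) => x Lx.
  rewrite /psi -mulrN; apply: le_trans (modulusD _ _) _.
  by rewrite modulusM lerD ?bP // ler_wpM2r ?modulus_ge0 ?bP'.
have W0 : 0 <= V / normc (phi ord0 z) by rewrite divr_ge0 // ltW.
have psiV (x : 'I_M -> X) : (forall i, L (x i)) ->
    normc (\det (\matrix_(i, j) psi j (x i))) <= V / normc (phi ord0 z).
  move=> Lx; rewrite ler_pdivlMr // mulrC -modulusM.
  pose x' (i : 'I_(1 + M)) := if unlift ord0 i is Some k then x k else z.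
  have Lx' i : L (x' i) by rewrite /x'; case: unliftP.
  suff <- : \det (\matrix_(i, j) phi j (x' i)) =
         phi ord0 z * \det (\matrix_(i, j) psi j (x i)) by exact: detV.
  have -> : \matrix_(i, j) phi j (x' i) =
      block_mx (phi ord0 z)%:M 0 (\col_i phi ord0 (x i)) (\matrix_(i, j) psi j (x i))
      *m block_mx 1%:M c 0 1%:M.
    rewrite mulmx_block !mulmx0 !mul0mx !mulmx1 !addr0 mul_scalar_mx.
    apply/matrixP => i j; rewrite -(@splitK 1 M i) -(@splitK 1 M j).
    case: (@fintype.split 1 M i) => i'; case: (@fintype.split 1 M j) => j' /=.
    - rewrite block_mxEul !mxE !ord1 /= mulr1n /x'.
      have -> : lshift M ord0 = ord0 :> 'I_(1 + M) by apply: val_inj.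
      by rewrite unlift_none.
    - rewrite block_mxEur !mxE !ord1 /= mulrC divfK // /x'.
      have -> : lshift M ord0 = ord0 :> 'I_(1 + M) by apply: val_inj.
      by rewrite unlift_none; congr phi; apply: val_inj.
    - rewrite block_mxEdl !mxE !ord1 /= /x'.
      have -> : lshift M ord0 = ord0 :> 'I_(1 + M) by apply: val_inj.
      have -> : rshift 1 i' = lift ord0 i' :> 'I_(1 + M) by apply: val_inj.
      by rewrite liftK.
    - rewrite block_mxEdr !mxE big_ord1 !mxE /psi /x' mxE.
      have -> : rshift 1 i' = lift ord0 i' :> 'I_(1 + M) by apply: val_inj.
      have -> : rshift 1 j' = lift ord0 j' :> 'I_(1 + M) by apply: val_inj.
      by rewrite liftK addrC subrK.
  by rewrite det_mulmx det_lblock det_ublock !det1 !mulr1 det_scalar1.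
have [U [b [U1 U0 b0 Ub bV]]] := IH psi _ psib W0 psiV.
exists (block_mx 1%:M (- (c *m U)) 0 U).
exists (fun j => if unlift ord0 j is Some k then b k else 2 * normc (phi ord0 z)).
split.
- move=> i; rewrite -(@splitK 1 M i); case: (@fintype.split 1 M i) => k /=.
    by rewrite block_mxEul mxE ord1 eqxx.
  by rewrite block_mxEdr.
- move=> i j; rewrite -(@splitK 1 M i) -(@splitK 1 M j).
  case: (@fintype.split 1 M i) => i'; case: (@fintype.split 1 M j) => j' /=.
  + by rewrite !ord1.
  + by rewrite ord1 ltnNge leq_addr.
  + by rewrite block_mxEdl mxE.
  + by rewrite block_mxEdr ltn_add2l; exact: U0.
- by move=> j; case: unliftP => [k|] _ //; rewrite mulr_ge0 // ltW.
- move=> j x Lx; rewrite -(@splitK 1 M j) (@big_split_ord _ _ _ 1 M) /= big_ord1.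
  case: (@fintype.split 1 M j) => j' /=.
    rewrite (ord1 j') block_mxEul mxE eqxx mulr1 big1 ?addr0; last first.
      by move=> i _; rewrite block_mxEdl mxE mulr0.
    have -> : lshift M ord0 = ord0 :> 'I_(1 + M) by apply: val_inj.
    by rewrite unlift_none phiz.
  have -> : lshift M ord0 = ord0 :> 'I_(1 + M) by apply: val_inj.
  have <- : lift ord0 j' = rshift 1 j' :> 'I_(1 + M) by apply: val_inj.
  rewrite liftK; apply: le_trans (Ub j' x Lx); rewrite le_eqVlt; apply/orP; left.
  apply/eqP; congr normc.
  have -> : lift ord0 j' = rshift 1 j' :> 'I_(1 + M) by apply: val_inj.
  have -> : ord0 = lshift M 0 :> 'I_(1 + M) by apply: val_inj.
  rewrite block_mxEur !mxE mulrN mulr_sumr -sumrN -big_split /=.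
  apply: eq_bigr => i _.
  rewrite block_mxEdr /psi mulrBl addrC mulrA; congr (_ * _ - _ * _ * _).
  + by congr phi; apply: val_inj.
  + by congr phi; apply: val_inj.
- rewrite big_ord_recl unlift_none exprS.
  under eq_bigr do rewrite liftK.
  rewrite -!mulrA ler_pM2l //.
  apply: le_trans (ler_wpM2l (modulus_ge0 _) bV) _.
  by rewrite mulrCA [normc _ * _]mulrC divfK ?gt_eqF.
Qed.

End NewtonBasis.

(** * Kronecker products *)

Section Determinants.
Variable A : comNzRingType.

(** Passing to a unitriangular basis does not change a Vandermonde determinant. *)
Lemma det_unitriangular n (U : 'M[A]_n) :
    (forall i, U i i = 1) -> (forall i j : 'I_n, (j < i)%N -> U i j = 0) ->
  \det U = 1.
Proof.
move=> U1 U0; rewrite -det_tr det_trig.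
  by apply: big1 => i _; rewrite mxE U1.
by apply/is_trig_mxP => i j ij; rewrite mxE U0.
Qed.

Lemma det_reindex n m (f : 'I_n -> 'I_m) (B : 'M[A]_m) :
  bijective f -> \det (\matrix_(i, j) B (f i) (f j)) = \det B.
Proof.
move=> bf; have enm : n = m by rewrite -[n]card_ord (bij_eq_card bf) card_ord.
case: m / enm f B bf => f B bf.
have -> : (\matrix_(i, j) B (f i) (f j)) =
    row_perm (perm (bij_inj bf)) (col_perm (perm (bij_inj bf)) B).
  by apply/matrixP => i j; rewrite !mxE !permE.
rewrite row_permE col_permE !det_mulmx mulrCA -det_mulmx -perm_mxM.
by rewrite mulgV perm_mx1 det1 mulr1.
Qed.

Lemma det_castmx n m (e : n = m) (B : 'M[A]_n) : \det (castmx (e, e) B) = \det B.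
Proof. by case: m / e; rewrite castmx_id. Qed.

Lemma det_1tens m n (B : 'M[A]_n) :
  \det (tensmx (1%:M : 'M[A]_m) B) = \det B ^+ m.
Proof.
elim: m => [|m IH]; first by rewrite expr0 det_mx00.
rewrite -[m.+1]/(1 + m)%N (scalar_mx_block 1 m) tens_block_mx.
rewrite !tens0mx det_castmx det_lblock IH exprS; congr (_ * _).
by rewrite -[1%:M]/1 tens_scalar1mx det_castmx.
Qed.

(** Swapping the two tensor factors permutes rows and columns simultaneously,
which reduces this to the block diagonal case. *)
Lemma det_tens1 m n (B : 'M[A]_m) :
  \det (tensmx B (1%:M : 'M[A]_n)) = \det B ^+ n.
Proof.
rewrite -(@det_1tens n m B).
pose f (i : 'I_(m * n)) := mxtens_index ((mxtens_unindex i).2, (mxtens_unindex i).1).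
have bf : bijective f.
  exists (fun i => mxtens_index ((mxtens_unindex i).2, (mxtens_unindex i).1)) => i;
  by rewrite /f mxtens_indexK -[RHS]mxtens_unindexK; case: (mxtens_unindex i).
rewrite -(det_reindex _ bf); congr (\det _); apply/matrixP => i j.
by rewrite !mxE /f !mxtens_indexK /= mulrC.
Qed.

Lemma det_tens m n (B : 'M[A]_m) (C : 'M[A]_n) :
  \det (tensmx B C) = \det B ^+ n * \det C ^+ m.
Proof. by rewrite tensmx_decr det_mulmx det_tens1 det_1tens. Qed.

End Determinants.

(** * Enumerations of box monomials *)

Section BoxMonomials.
Variables (s : nat) (N : 'I_s -> nat).

Lemma mem_box_monomials (m : multinom s) :
  (m \in box_monomials N) = [forall t, (m t < N t)%N].
Proof.
rewrite mem_sort; apply/mapP/forallP => [[f _ ->] t|mN].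
  by rewrite multinomE tnth_mktuple.
exists [ffun t => Ordinal (mN t)]; first by rewrite mem_enum.
by apply/mnmP => t; rewrite multinomE tnth_mktuple ffunE.
Qed.

Lemma box_monomials_uniq : uniq (box_monomials N).
Proof.
rewrite sort_uniq map_inj_uniq ?enum_uniq // => f g /mnmP fg.
apply/ffunP => t; apply: val_inj => /=.
by move: (fg t); rewrite !multinomE !tnth_mktuple.
Qed.

(** The columns of a Vandermonde determinant are listed in whichever order suits
the argument; only the sign depends on it. *)
Definition box_enum n (e : 'I_n -> multinom s) : Prop :=
  injective e /\ forall m, (m \in box_monomials N) <-> exists j, m = e j.

Lemma box_enum_size n (e : 'I_n -> multinom s) : box_enum e -> n = box_size N.
Proof.
move=> [injE eN]; rewrite -size_box_monomials.
have /perm_size <- : perm_eq (codom e) (box_monomials N).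
  apply: uniq_perm; rewrite ?box_monomials_uniq //; first exact/injectiveP.
  by move=> m; apply/codomP/idP => [/eN //|/eN].
by rewrite size_codom card_ord.
Qed.

Definition box_nth (j : 'I_(box_size N)) : multinom s :=
  nth (@mnm0 s) (box_monomials N) j.

Lemma box_nth_enum : box_enum box_nth.
Proof.
split=> [i j /eqP|m].
  rewrite nth_uniq ?size_box_monomials // ?box_monomials_uniq //.
  by move=> /eqP ij; apply: val_inj.
split=> [mN|[j ->]]; last by rewrite mem_nth // size_box_monomials.
have ltm : (index m (box_monomials N) < box_size N)%N.
  by rewrite -size_box_monomials index_mem.
by exists (Ordinal ltm); rewrite /box_nth /= nth_index.
Qed.

Lemma box_enum_perm n (e e' : 'I_n -> multinom s) :
  box_enum e -> box_enum e' -> exists p : 'S_n, forall j, e' j = e (p j).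
Proof.
move=> [injE eN] [injE' eN'].
have /choice[f fE] j : exists i, e' j = e i by apply/eN/eN'; exists j.
have injf : injective f.
  by move=> i j ij; apply: injE'; rewrite !fE ij.
by exists (perm injf) => j; rewrite permE.
Qed.

End BoxMonomials.

(** * Suprema of Vandermonde determinants *)

Section Vandermonde.
Variables (R : realType) (s : nat).
Local Notation C := (Cplx R).

Definition mono (z : 'rV[C]_s) (m : multinom s) : C := \prod_t z 0 t ^+ m t.

Definition vdet n (e : 'I_n -> multinom s) (z : 'I_n -> 'rV[C]_s) : C :=
  \det (\matrix_(i, j) mono (z i) (e j)).

Definition bounded_by (c : R) (L : set 'rV[C]_s) : Prop :=
  1 <= c /\ forall z, L z -> forall t, normc (z 0 t) <= c.

(** The normalizing root is left out, since the estimates are multiplicative in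
the determinant itself. *)
Definition vmax (L : set 'rV[C]_s) (N : 'I_s -> nat) : R :=
  sup [set normc (\det (vandermonde z))
      | z in [set z : 'M[C]_(box_size N, s) | forall i, L (row i z)]].

Lemma mono_le c L z m : bounded_by c L -> L z ->
  normc (mono z m) <= c ^+ mdeg m.
Proof.
move=> [c1 Lc] Lz; rewrite modulus_prod mdegE -prodrXr.
apply: ler_prod => t _; rewrite modulus_ge0 modulusX /=.
by rewrite lerXn2r // ?nnegrE ?modulus_ge0 ?Lc // (le_trans ler01).
Qed.

Lemma vdet_vandermonde (N : 'I_s -> nat) (z : 'M[C]_(box_size N, s)) :
  \det (vandermonde z) = vdet (@box_nth s N) (fun i => row i z).
Proof.
congr (\det _); apply/matrixP => i j; rewrite !mxE.
by apply: eq_bigr => t _; rewrite mxE.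
Qed.

Lemma vdet_enum N n (e e' : 'I_n -> multinom s) z :
  box_enum N e -> box_enum N e' -> normc (vdet e z) = normc (vdet e' z).
Proof.
move=> he he'; have [p pE] := box_enum_perm he he'.
have -> : vdet e' z = \det (col_perm p (\matrix_(i, j) mono (z i) (e j))).
  by congr (\det _); apply/matrixP => i j; rewrite !mxE pE.
by rewrite col_permE det_mulmx det_perm modulusM modulus_sign mulr1.
Qed.

Lemma vdet_bounded c L n (e : 'I_n -> multinom s) z :
  bounded_by c L -> (forall i, L (z i)) ->
  normc (vdet e z) <= n`!%:R * \prod_j c ^+ mdeg (e j).
Proof.
by move=> Lc Lz; apply: modulus_det_le => i j; rewrite mxE (mono_le _ Lc).
Qed.

Lemma vmax_ge0 L N : 0 <= vmax L N.
Proof.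
rewrite /vmax; set E := (X in sup X).
have [[[x Ex] bE]|/sup_out -> //] := pselect (has_sup E).
apply: le_trans (ub_le_sup bE Ex); case: Ex => z _ <-.
exact: modulus_ge0.
Qed.

Lemma vmax_has_ubound c L N : bounded_by c L ->
  has_ubound [set normc (\det (vandermonde z))
      | z in [set z : 'M[C]_(box_size N, s) | forall i, L (row i z)]].
Proof.
move=> Lc; exists ((box_size N)`!%:R * \prod_j c ^+ mdeg (@box_nth s N j)).
by move=> _ [z Lz <-]; rewrite vdet_vandermonde (vdet_bounded _ Lc).
Qed.

Lemma vmax_ub c L N n (e : 'I_n -> multinom s) z :
    bounded_by c L -> box_enum N e -> (forall i, L (z i)) ->
  normc (vdet e z) <= vmax L N.
Proof.
move=> Lc he; have en := box_enum_size he; subst n => Lz.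
rewrite (vdet_enum _ he (@box_nth_enum s N)).
apply: ub_le_sup; first exact: vmax_has_ubound Lc.
exists (\matrix_(i, t) z i 0 t) => [i|].
  by have -> : row i (\matrix_(i, t) z i 0 t) = z i by apply/rowP => t; rewrite !mxE.
rewrite vdet_vandermonde; congr (normc (\det _)); apply/matrixP => i j.
by rewrite !mxE; congr (mono _ _); apply/rowP => t; rewrite !mxE.
Qed.

Lemma vmax_le L N n (e : 'I_n -> multinom s) (V : R) :
    0 <= V -> box_enum N e ->
    (forall z, (forall i, L (z i)) -> normc (vdet e z) <= V) ->
  vmax L N <= V.
Proof.
move=> V0 he; have en := box_enum_size he; subst n => VP.
have [ne|ne] := pselect ([set normc (\det (vandermonde z))
      | z in [set z : 'M[C]_(box_size N, s) | forall i, L (row i z)]] !=set0).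
  apply: ge_sup => // _ [z Lz <-].
  by rewrite vdet_vandermonde (vdet_enum _ (@box_nth_enum s N) he) VP.
by rewrite /vmax sup_out // => -[].
Qed.

Lemma chebyshev_basis c L N n (e : 'I_n -> multinom s) :
    bounded_by c L -> box_enum N e ->
  exists (U : 'M[C]_n) (b : 'I_n -> R),
    [/\ forall i, U i i = 1, forall i j : 'I_n, (j < i)%N -> U i j = 0,
        forall j, 0 <= b j,
        forall j z, L z -> normc (\sum_i mono z (e i) * U i j) <= b j
      & \prod_j b j <= 2 ^+ n * vmax L N].
Proof.
move=> Lc he; apply: (@newton_basis _ _ L _ (fun j z => mono z (e j))).
- by move=> j; exists (c ^+ mdeg (e j)) => z; exact: mono_le.
- exact: vmax_ge0.
- by move=> z Lz; exact: (vmax_ub Lc he).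
Qed.

End Vandermonde.

(** * Product sets *)

(** Sets without a finite supremum, such as the empty one, have supremum 0 and obey
the bound because 0 < p. *)
Lemma sup_expr_le (R : realType) (E : set R) p (c V : R) :
    (0 < p)%N -> (forall x, E x -> 0 <= x) -> 0 <= c -> 0 <= V ->
    (forall x, E x -> x ^+ p * c <= V) ->
  sup E ^+ p * c <= V.
Proof.
move=> p0 E0 c0 V0 EV; have [supE|/sup_out ->] := pselect (has_sup E); last first.
  by rewrite expr0n gtn_eqF // mul0r.
have [[x Ex] _] := supE.
have [->|cn0] := eqVneq c 0; first by rewrite mulr0.
have cp : 0 < c by rewrite lt_def cn0.
have pn0 : p%:R != 0 :> R by rewrite pnatr_eq0 -lt0n.
rewrite -ler_pdivlMr //; set W := V / c.
have W0 : 0 <= W by rewrite divr_ge0.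
have rootW : (W `^ p%:R^-1) ^+ p = W.
  by rewrite -powR_mulrn ?powR_ge0 // -powRrM mulVf // powRr1.
rewrite -rootW lerXn2r ?nnegrE ?powR_ge0 //.
  by apply: (@le_trans _ _ x); [exact: E0 | exact: sup_upper_bound].
apply: ge_sup; first by exists x.
move=> y Ey; rewrite -(@ler_pXn2r _ p) ?nnegrE ?powR_ge0 ?E0 //.
by rewrite rootW /W ler_pdivlMr // EV.
Qed.

Section ProductSets.
Variables (R : realType) (k l : nat) (N : 'I_(k + l) -> nat).
Local Notation C := (Cplx R).

Let N1 (t : 'I_k) := N (lshift l t).
Let N2 (t : 'I_l) := N (rshift k t).

Definition mcat (m1 : multinom k) (m2 : multinom l) : multinom (k + l) :=
  Multinom [tuple match fintype.split t with inl t1 => m1 t1 | inr t2 => m2 t2 end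
           | t < k + l].

Lemma mcat_lshift m1 m2 t : mcat m1 m2 (lshift l t) = m1 t.
Proof. by rewrite multinomE tnth_mktuple (unsplitK (inl t)). Qed.

Lemma mcat_rshift m1 m2 t : mcat m1 m2 (rshift k t) = m2 t.
Proof. by rewrite multinomE tnth_mktuple (unsplitK (inr t)). Qed.

Lemma mono_mcat (z : 'rV[C]_(k + l)) m1 m2 :
  mono z (mcat m1 m2) = mono (lsubmx z) m1 * mono (rsubmx z) m2.
Proof.
rewrite /mono big_split_ord; congr (_ * _); apply: eq_bigr => t _ /=.
  by rewrite mcat_lshift mxE.
by rewrite mcat_rshift mxE.
Qed.

Definition tens_enum n1 n2 (e1 : 'I_n1 -> multinom k) (e2 : 'I_n2 -> multinom l)
    (j : 'I_(n1 * n2)) : multinom (k + l) :=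
  mcat (e1 (mxtens_unindex j).1) (e2 (mxtens_unindex j).2).

Lemma tens_enumP n1 n2 (e1 : 'I_n1 -> multinom k) (e2 : 'I_n2 -> multinom l) :
  box_enum N1 e1 -> box_enum N2 e2 -> box_enum N (tens_enum e1 e2).
Proof.
move=> [inj1 eN1] [inj2 eN2]; split.
  move=> i j /mnmP ij.
  apply: (can_inj (@mxtens_unindexK n1 n2)).
  rewrite [LHS]surjective_pairing [RHS]surjective_pairing; congr (_, _).
    by apply: inj1; apply/mnmP => t; move: (ij (lshift l t)); rewrite !mcat_lshift.
  by apply: inj2; apply/mnmP => t; move: (ij (rshift k t)); rewrite !mcat_rshift.
move=> m; rewrite mem_box_monomials; split=> [/forallP mN|[j ->]].
  have /eN1[j1 mj1] : Multinom [tuple m (lshift l t) | t < k] \in box_monomials N1.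
    by rewrite mem_box_monomials; apply/forallP => t; rewrite multinomE tnth_mktuple.
  have /eN2[j2 mj2] : Multinom [tuple m (rshift k t) | t < l] \in box_monomials N2.
    by rewrite mem_box_monomials; apply/forallP => t; rewrite multinomE tnth_mktuple.
  exists (mxtens_index (j1, j2)); rewrite /tens_enum mxtens_indexK /=.
  rewrite -mj1 -mj2.
  apply/mnmP => t; rewrite -(splitK t); case: (fintype.split t) => t' /=.
    by rewrite mcat_lshift multinomE tnth_mktuple.
  by rewrite mcat_rshift multinomE tnth_mktuple.
have /forallP m1 : [forall t, e1 (mxtens_unindex j).1 t < N1 t]%N.
  by rewrite -mem_box_monomials; apply/eN1; eexists.
have /forallP m2 : [forall t, e2 (mxtens_unindex j).2 t < N2 t]%N.
  by rewrite -mem_box_monomials; apply/eN2; eexists.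
apply/forallP => t; rewrite -(splitK t); case: (fintype.split t) => t' /=.
  by rewrite mcat_lshift m1.
by rewrite mcat_rshift m2.
Qed.

Lemma prod_tens n1 n2 (a1 : 'I_n1 -> R) (a2 : 'I_n2 -> R) :
  \prod_(j < n1 * n2) (a1 (mxtens_unindex j).1 * a2 (mxtens_unindex j).2) =
  (\prod_j a1 j) ^+ n2 * (\prod_j a2 j) ^+ n1.
Proof.
rewrite (reindex (@mxtens_index n1 n2)); last first.
  by exists (@mxtens_unindex n1 n2) => i _; rewrite ?mxtens_indexK ?mxtens_unindexK.
under eq_bigr do rewrite mxtens_indexK.
rewrite -(pair_bigA _ (fun i j => a1 i * a2 j)) /=.
under eq_bigr do rewrite big_split /= prodr_const card_ord.
by rewrite big_split /= prodrXl prodr_const card_ord.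
Qed.

Variables (K1 : set 'rV[C]_k) (K2 : set 'rV[C]_l) (c : R).
Hypotheses (bK1 : bounded_by c K1) (bK2 : bounded_by c K2).

Lemma prod_set_bounded : bounded_by c (prod_set K1 K2).
Proof.
split=> [|z [zK1 zK2] t]; first by case: bK1.
rewrite -(splitK t); case: (fintype.split t) => t' /=.
  by have := (bK1.2 _ zK1 t'); rewrite mxE.
by have := (bK2.2 _ zK2 t'); rewrite mxE.
Qed.

(** At the points (x_i, y_j) the matrix is the Kronecker product of the two
Vandermonde matrices. *)
Lemma vmax_prod_ge n1 n2 (e1 : 'I_n1 -> multinom k) (e2 : 'I_n2 -> multinom l) z1 z2 :
    box_enum N1 e1 -> box_enum N2 e2 ->
    (forall i, K1 (z1 i)) -> (forall i, K2 (z2 i)) ->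
  normc (vdet e1 z1) ^+ n2 * normc (vdet e2 z2) ^+ n1 <= vmax (prod_set K1 K2) N.
Proof.
move=> he1 he2 Kz1 Kz2.
pose z (i : 'I_(n1 * n2)) : 'rV[C]_(k + l) :=
  row_mx (z1 (mxtens_unindex i).1) (z2 (mxtens_unindex i).2).
have Kz i : prod_set K1 K2 (z i).
  by split; rewrite ?row_mxKl ?row_mxKr.
have := vmax_ub prod_set_bounded (tens_enumP he1 he2) Kz.
suff -> : vdet (tens_enum e1 e2) z = vdet e1 z1 ^+ n2 * vdet e2 z2 ^+ n1.
  by rewrite modulusM !modulusX.
rewrite -det_tens; congr (\det _); apply/matrixP => i j.
by rewrite !mxE mono_mcat row_mxKl row_mxKr.
Qed.

Lemma vmax_prod_ge_sup :
    (0 < box_size N1)%N -> (0 < box_size N2)%N ->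
  vmax K1 N1 ^+ box_size N2 * vmax K2 N2 ^+ box_size N1 <= vmax (prod_set K1 K2) N.
Proof.
move=> N10 N20.
apply: sup_expr_le; rewrite ?exprn_ge0 ?vmax_ge0 //.
  by move=> _ [z _ <-]; exact: modulus_ge0.
move=> _ [z1 Kz1 <-]; rewrite mulrC.
apply: sup_expr_le; rewrite ?exprn_ge0 ?vmax_ge0 ?modulus_ge0 //.
  by move=> _ [z _ <-]; exact: modulus_ge0.
move=> _ [z2 Kz2 <-]; rewrite mulrC !vdet_vandermonde.
by apply: vmax_prod_ge => //; exact: box_nth_enum.
Qed.

(** The products of the two Newton bases form a unitriangular basis for the
product set, and their norms multiply. *)
Lemma vmax_prod_le :
  vmax (prod_set K1 K2) N <=
  (box_size N)`!%:R * 4 ^+ box_size N *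
  (vmax K1 N1 ^+ box_size N2 * vmax K2 N2 ^+ box_size N1).
Proof.
have he1 := @box_nth_enum k N1; have he2 := @box_nth_enum l N2.
have he := tens_enumP he1 he2; rewrite -(box_enum_size he).
apply: (vmax_le _ he).
  by rewrite !mulr_ge0 // ?exprn_ge0 ?vmax_ge0.
move=> z Kz.
have [U1 [b1 [U11 U10 b10 Ub1 b1V]]] := chebyshev_basis bK1 he1.
have [U2 [b2 [U21 U20 b20 Ub2 b2V]]] := chebyshev_basis bK2 he2.
set W := \matrix_(i, j) mono (z i) (tens_enum (@box_nth k N1) (@box_nth l N2) j).
have -> : vdet (tens_enum (@box_nth k N1) (@box_nth l N2)) z =
    \det (W *m tensmx U1 U2).
  by rewrite det_mulmx det_tens (det_unitriangular U11 U10)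
    (det_unitriangular U21 U20) !expr1n !mulr1.
apply: le_trans (@modulus_det_le _ _ _
  (fun j => b1 (mxtens_unindex j).1 * b2 (mxtens_unindex j).2) _) _.
  move=> i j; rewrite mxE.
  have -> : \sum_j0 W i j0 * tensmx U1 U2 j0 j =
      (\sum_a mono (lsubmx (z i)) (box_nth a) * U1 a (mxtens_unindex j).1) *
      (\sum_b mono (rsubmx (z i)) (box_nth b) * U2 b (mxtens_unindex j).2).
    rewrite mulr_sum; apply: eq_bigr => a _; rewrite !mxE mono_mcat.
    by rewrite mulrACA.
  rewrite modulusM; have [Kz1 Kz2] := Kz i.
  by apply: ler_pM; rewrite ?modulus_ge0 ?Ub1 ?Ub2.
rewrite -mulrA ler_wpM2l // prod_tens.
have -> : 4 ^+ (box_size N1 * box_size N2) *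
    (vmax K1 N1 ^+ box_size N2 * vmax K2 N2 ^+ box_size N1) =
    (2 ^+ box_size N1 * vmax K1 N1) ^+ box_size N2 *
    (2 ^+ box_size N2 * vmax K2 N2) ^+ box_size N1.
  rewrite !exprMn -!exprM [(box_size N2 * _)%N]mulnC mulrACA -exprMn.
  by congr (_ ^+ _ * _); rewrite -natrM.
by apply: ler_pM; rewrite ?exprn_ge0 ?prodr_ge0 // lerXn2r //
  ?nnegrE ?prodr_ge0 ?mulr_ge0 ?exprn_ge0 ?vmax_ge0.
Qed.

End ProductSets.

(** * The degree of the generic determinant *)

Section Degree.
Variables (s : nat) (N : 'I_s -> nat).
Hypothesis N0 : forall t, (0 < N t)%N.

Lemma box_size_gt0 : (0 < box_size N)%N.
Proof. exact: prodn_gt0. Qed.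

(** The involution m_t -> N_t - 1 - m_t of the box pairs each exponent with its
complement, so the average of m_t is (N_t - 1) / 2. *)
Lemma sum_mdeg_box :
  (2 * \sum_(m <- box_monomials N) mdeg m = box_size N * \sum_t (N t).-1)%N.
Proof.
rewrite (perm_big _ (permEl (perm_sort _ _))) big_map big_enum /=.
under eq_bigr do rewrite mdegE.
(* Reflection of the box in its centre. *)
pose opp (f : {dffun forall t, 'I_(N t)}) : {dffun forall t, 'I_(N t)} :=
  [ffun t => rev_ord (f t)].
have oppK : involutive opp by move=> f; apply/ffunP => t; rewrite !ffunE rev_ordK.
rewrite mul2n -addnn {1}(reindex_inj (inv_inj oppK)) /= -big_split /=.
have -> : box_size N = #|{dffun forall t, 'I_(N t)}|.
  rewrite card_dep_ffun foldrE big_map big_enum /=.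
  by apply: eq_bigr => t _; rewrite card_ord.
rewrite -sum_nat_const; apply: eq_bigr => f _.
rewrite -big_split /=; apply: eq_bigr => t _.
rewrite !multinomE !tnth_mktuple ffunE /=.
by rewrite -subn1; have := ltn_ord (f t); lia.
Qed.

Variable R : realType.
Local Notation C := (Cplx R).

Definition generic_mnm (i : 'I_(box_size N)) (m : multinom s) :
    multinom (box_size N * s) :=
  (\big[@mnm_add _/@mnm0 _]_(t < s) mnm_muln (mnm1 (mxvec_index i t)) (m t))%N.

(** The monomial contributed by the permutation [p] to the Leibniz expansion of
the generic determinant. *)
Definition generic_term (p : 'S_(box_size N)) : multinom (box_size N * s) :=
  (\big[@mnm_add _/@mnm0 _]_i generic_mnm i (box_nth (p i)))%N.

Lemma generic_termE p i t : generic_term p (mxvec_index i t) = box_nth (p i) t.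
Proof.
rewrite mnm_sumE; under eq_bigr => i' _.
  rewrite mnm_sumE; under eq_bigr do rewrite mulmnE mnm1E.
  over.
rewrite pair_big /= (bigD1 (i, t)) //= eqxx mul1n big1 ?addn0 // => -[i' t'] /= it.
suff -> : (mxvec_index i' t' == mxvec_index i t) = false by rewrite mul0n.
apply: contraNF it => /eqP E.
by move: E => /cast_ord_inj /enum_rank_inj ->.
Qed.

Lemma mdeg_generic_term p : mdeg (generic_term p) = (\sum_(m <- box_monomials N) mdeg m)%N.
Proof.
rewrite mdeg_sum; under eq_bigr => i _.
  rewrite mdeg_sum; under eq_bigr do rewrite mdegMn mdeg1 mul1n.
  rewrite -mdegE; over.
rewrite (big_nth (@mnm0 s)) size_box_monomials big_mkord.
by rewrite [RHS](reindex_inj (@perm_inj _ p)).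
Qed.

Lemma generic_det :
  \det (vandermonde (generic_points R N)) =
  \sum_(p : 'S_(box_size N)) (-1) ^+ p * mpolyX C (generic_term p).
Proof.
apply: eq_bigr => p _; congr (_ * _).
rewrite -mprodXE; apply: eq_bigr => i _; rewrite mxE -mprodXnE.
by apply: eq_bigr => t _; rewrite mxE.
Qed.

(** The generic determinant is homogeneous, because each column has a fixed
degree; it is nonzero because distinct permutations contribute distinct monomials. *)
Lemma det_degree_sum : det_degree R N = (\sum_(m <- box_monomials N) mdeg m)%N.
Proof.
rewrite /det_degree; set p := \det _; set D := (\sum_(m <- _) _)%N.
have pD : p \is @ishomog1 _ _ D mdeg.
  rewrite /p generic_det; apply: rpred_sum => q _.
  by rewrite rpredMsign dhomogX; apply/eqP; exact: mdeg_generic_term.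
suff p0 : p != 0 by rewrite -(dhomog_uniq p0 pD (dhomog_msize pD)).
suff : mcoeff (generic_term 1%g) p != 0 by apply: contraNneq => ->; rewrite mcoeff0.
rewrite /p generic_det raddf_sum (bigD1 1%g) //= odd_perm1 expr0 mul1r.
rewrite mcoeffX eqxx big1 ?addr0 ?oner_eq0 // => q q1.
rewrite -signr_odd mulr_sign; suff : generic_term q != generic_term 1%g.
  by case: odd => /negbTE E; rewrite ?mcoeffN mcoeffX E ?oppr0.
apply: contraNneq q1 => /mnmP E; apply/eqP/permP => i; rewrite perm1.
apply: (box_nth_enum N).1; apply/mnmP => t.
by rewrite -generic_termE E generic_termE perm1.
Qed.

Lemma det_degreeE :
  (det_degree R N)%:R = (box_size N)%:R * (\sum_t ((N t)%:R - 1) / 2) :> R.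
Proof.
rewrite det_degree_sum -mulr_suml mulrA.
apply: (@mulIf _ 2); first by rewrite pnatr_eq0.
rewrite divfK ?pnatr_eq0 // mulrC -natrM sum_mdeg_box natrM natr_sum.
by congr (_ * _); apply: eq_bigr => t _; rewrite -subn1 natrB.
Qed.

End Degree.

(** * Monic polynomials in a box *)

Section MonicPolynomials.
Variables (R : realType) (s : nat).
Local Notation C := (Cplx R).
Local Notation poly := (mpoly s C).

Lemma box_nth_le N (i j : 'I_(box_size N)) : (i <= j)%N ->
  (box_nth i <= box_nth j :> multinom s)%O.
Proof.
move=> ij; apply: (sorted_leq_nth le_trans le_refl) => //.
- exact: (sort_sorted le_total).
- by rewrite inE size_box_monomials.
- by rewrite inE size_box_monomials.
Qed.

(** Leading monomials are taken for the degree-lexicographic order, which makes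
changes of basis among the [box_monomials] unitriangular and is compatible with
products. *)
Definition monic_at (N : 'I_s -> nat) (a : multinom s) (p : poly) : Prop :=
  [/\ mlead p = a, mcoeff a p = 1 & {subset msupp p <= box_monomials N}].

Lemma box_bigE N (V : nmodType) (F : multinom s -> V) :
  \sum_(a <- box_monomials N) F a = \sum_(j < box_size N) F (box_nth j).
Proof. by rewrite (big_nth (@mnm0 s)) size_box_monomials big_mkord. Qed.

Lemma box_bigprodE N (F : multinom s -> R) :
  \prod_(a <- box_monomials N) F a = \prod_(j < box_size N) F (box_nth j).
Proof. by rewrite (big_nth (@mnm0 s)) size_box_monomials big_mkord. Qed.

Lemma meval_box N (p : poly) (z : 'rV[C]_s) :
    {subset msupp p <= box_monomials N} ->
  meval (z 0) p = \sum_(j < box_size N) mono z (box_nth j) * mcoeff (box_nth j) p.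
Proof.
move=> pN; rewrite mevalE -(box_bigE _ (fun a => mono z a * mcoeff a p)).
rewrite [RHS](bigID (mem (msupp p))) /= [X in _ + X]big1 ?addr0; last first.
  by move=> a /memN_msupp_eq0 ->; rewrite mulr0.
rewrite -[RHS]big_filter; have pE : perm_eq (msupp p) [seq a <- box_monomials N | a \in msupp p].
  apply: uniq_perm; rewrite ?filter_uniq ?box_monomials_uniq ?msupp_uniq //.
  by move=> a; rewrite mem_filter andb_idr // => /pN.
by rewrite -(perm_big _ pE); apply: eq_bigr => a _; rewrite mulrC.
Qed.

(** Monic polynomials, one for each monomial of the box, have the same
determinant as the monomials. *)
Lemma vmax_monic_le (L : set 'rV[C]_s) N (T : multinom s -> poly)
    (b : multinom s -> R) :
    (forall a, a \in box_monomials N -> monic_at N a (T a)) ->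
    (forall a, 0 <= b a) ->
    (forall a z, a \in box_monomials N -> L z -> normc (meval (z 0) (T a)) <= b a) ->
  vmax L N <= (box_size N)`!%:R * \prod_(a <- box_monomials N) b a.
Proof.
move=> Tmon b0 Tb.
have inN (j : 'I_(box_size N)) : box_nth j \in box_monomials N.
  by apply/(box_nth_enum N).2; exists j.
apply: (vmax_le _ (box_nth_enum N)).
  by rewrite mulr_ge0 // prodr_ge0.
move=> z Lz; pose U : 'M[C]_(box_size N) :=
  \matrix_(i, j) mcoeff (box_nth i) (T (box_nth j)).
have -> : vdet (@box_nth s N) z =
    \det ((\matrix_(i, j) mono (z i) (box_nth j)) *m U).
  rewrite det_mulmx (@det_unitriangular _ _ U) ?mulr1 //.
    by move=> j; rewrite mxE; have [] := Tmon _ (inN j).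
  move=> i j ji; rewrite mxE; apply: mcoeff_gt_mlead.
  have [-> _ _] := Tmon _ (inN j).
  rewrite lt_neqAle box_nth_le 1?ltnW // andbT.
  by apply: contraTneq ji => /(box_nth_enum N).1 ->; rewrite ltnn.
rewrite box_bigprodE; apply: modulus_det_le => i j; rewrite mxE.
have -> : \sum_k (\matrix_(i, j) mono (z i) (box_nth j)) i k * U k j =
    meval (z i 0) (T (box_nth j)).
  have [_ _ TN] := Tmon _ (inN j); rewrite (meval_box _ TN).
  by apply: eq_bigr => k _; rewrite !mxE.
exact: Tb.
Qed.

(** The Newton basis of the box, seen as polynomials. *)
Lemma chebyshev_polynomials c (L : set 'rV[C]_s) N : bounded_by c L ->
  exists (T : multinom s -> poly) (b : multinom s -> R),
    [/\ forall a, a \in box_monomials N -> monic_at N a (T a),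
        forall a, 0 <= b a,
        forall a z, a \in box_monomials N -> L z -> normc (meval (z 0) (T a)) <= b a
      & \prod_(a <- box_monomials N) b a <= 2 ^+ box_size N * vmax L N].
Proof.
move=> Lc; have [U [b [U1 U0 b0 Ub bV]]] := chebyshev_basis Lc (box_nth_enum N).
pose T j : poly := \sum_i U i j *: mpolyX C (box_nth i).
have injN := (box_nth_enum N).1.
have TE j i : mcoeff (box_nth i) (T j) = U i j.
  rewrite raddf_sum /= (bigD1 i) //= mcoeffZ mcoeffX eqxx mulr1 big1 ?addr0 //.
  move=> k ki; rewrite mcoeffZ mcoeffX.
  suff -> : (box_nth k == box_nth i :> multinom s) = false by rewrite mulr0.
  by apply: contraNF ki => /eqP /injN ->.
have Tsupp j a : a \in msupp (T j) -> exists2 i : 'I_(box_size N), (i <= j)%N & a = box_nth i.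
  move=> aT; have aT0 : mcoeff a (T j) != 0 by rewrite -mcoeff_msupp.
  have [[i /eqP aE]|/forallNP na] := pselect (exists i : 'I_(box_size N), box_nth i == a).
    exists i => //; rewrite leqNgt; apply: contraNN aT0 => ji.
    by rewrite -aE TE U0.
  case/eqP: aT0; rewrite raddf_sum /= big1 // => i _.
  by rewrite mcoeffZ mcoeffX; move/negP/negbTE: (na i) => ->; rewrite mulr0.
have sumE (V : nmodType) (F : 'I_(box_size N) -> V) j :
    \sum_(i | box_nth i == box_nth j :> multinom s) F i = F j.
  by rewrite (big_pred1 j) // => i /=; rewrite (inj_eq injN).
exists (fun a => \sum_(j | box_nth j == a) T j), (fun a => \sum_(j | box_nth j == a) b j).
split.
- move=> _ /(box_nth_enum N).2 [j ->]; rewrite sumE; split.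
  + have Tj0 : T j != 0.
      by apply/eqP => Tj; have := TE j j; rewrite Tj mcoeff0 U1 => /esym/eqP; rewrite oner_eq0.
    apply/eqP; rewrite eq_le msupp_le_mlead ?andbT; last first.
      by rewrite mcoeff_msupp TE U1 oner_neq0.
    by have [i ij ->] := Tsupp j _ (mlead_supp Tj0); exact: box_nth_le.
  + by rewrite TE U1.
  + by move=> a /Tsupp[i _ ->]; apply/(box_nth_enum N).2; exists i.
- by move=> a; apply: sumr_ge0.
- move=> _ z /(box_nth_enum N).2 [j ->] Lz; rewrite !sumE.
  have := Ub j z Lz; congr (normc _ <= _); rewrite raddf_sum /=.
  by apply: eq_bigr => i _; rewrite mevalZ mevalX mulrC.
- by rewrite box_bigprodE; under eq_bigr do rewrite sumE.
Qed.

End MonicPolynomials.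

(** * Growth of Vandermonde determinants on cubes *)

Section Growth.
Variables (R : realType) (s : nat).
Local Notation C := (Cplx R).
Local Notation poly := (mpoly s C).
Local Notation cube n := (fun _ : 'I_s => n).

Lemma box_size_cube n : box_size (cube n) = (n ^ s)%N.
Proof. by rewrite /box_size prod_nat_const card_ord. Qed.

Lemma mem_cube n (a : multinom s) :
  reflect (forall t, a t < n)%N (a \in box_monomials (cube n)).
Proof. by rewrite mem_box_monomials; exact: forallP. Qed.

Lemma mem_cube_sub m n : (m <= n)%N ->
  {subset box_monomials (cube m) <= box_monomials (cube n)}.
Proof.
by move=> mn a /mem_cube am; apply/mem_cube => t; exact: leq_trans (am t) mn.
Qed.

Lemma mdeg_cube_le n (a : multinom s) : a \in box_monomials (cube n) ->
  (mdeg a <= s * n)%N.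
Proof.
move=> /mem_cube an; rewrite mdegE.
apply: (@leq_trans (\sum_(t < s) n)); first by apply: leq_sum => t _; exact: ltnW.
by rewrite sum_nat_const card_ord.
Qed.

Definition mcomb q (g r : multinom s) : multinom s := mnm_add (mnm_muln g q) r.

Lemma mcombE q g r t : mcomb q g r t = (g t * q + r t)%N.
Proof. by rewrite mnmDE mulmnE. Qed.

Definition mquot q (a : multinom s) : multinom s := Multinom [tuple (a t %/ q)%N | t < s].
Definition mrem q (a : multinom s) : multinom s := Multinom [tuple (a t %% q)%N | t < s].

Lemma mquotE q a t : mquot q a t = (a t %/ q)%N.
Proof. by rewrite multinomE tnth_mktuple. Qed.

Lemma mremE q a t : mrem q a t = (a t %% q)%N.
Proof. by rewrite multinomE tnth_mktuple. Qed.

Lemma mcomb_divmod q a : mcomb q (mquot q a) (mrem q a) = a.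
Proof. by apply/mnmP => t; rewrite mcombE mquotE mremE -divn_eq. Qed.

Lemma mquot_comb q g r : r \in box_monomials (cube q) -> mquot q (mcomb q g r) = g.
Proof.
move=> /mem_cube rq; apply/mnmP => t; rewrite mquotE mcombE.
by rewrite divnMDl ?divn_small ?addn0 // (leq_ltn_trans _ (rq t)).
Qed.

Lemma mrem_comb q g r : r \in box_monomials (cube q) -> mrem q (mcomb q g r) = r.
Proof.
move=> /mem_cube rq; apply/mnmP => t; rewrite mremE mcombE.
by rewrite modnMDl modn_small.
Qed.

Lemma mquot_cube m q a : (0 < q)%N -> a \in box_monomials (cube (q * m)) ->
  mquot q a \in box_monomials (cube m).
Proof.
move=> q0 /mem_cube am; apply/mem_cube => t.
by rewrite mquotE ltn_divLR // mulnC am.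
Qed.

Lemma mrem_cube q a : (0 < q)%N -> mrem q a \in box_monomials (cube q).
Proof. by move=> q0; apply/mem_cube => t; rewrite mremE ltn_mod. Qed.

(** Euclidean division of exponents: the cube of side q m splits as q times the
cube of side m plus the cube of side q. *)
Lemma cube_perm m q : (0 < q)%N ->
  perm_eq (box_monomials (cube (q * m)))
    [seq mcomb q g r | g <- box_monomials (cube m), r <- box_monomials (cube q)].
Proof.
move=> q0; apply: uniq_perm; first exact: box_monomials_uniq.
  apply: allpairs_uniq; rewrite ?box_monomials_uniq // => -[g r] [g' r'].
  move=> /allpairsP[[g1 r1] /= [_ rq [-> ->]]] /allpairsP[[g2 r2] /= [_ rq' [-> ->]]] E.
  by congr (_, _); [rewrite -(mquot_comb g1 rq) E mquot_comb
                  | rewrite -(mrem_comb g1 rq) E mrem_comb].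
move=> a; apply/idP/allpairsP => [am|[[g r] /= [/mem_cube gm /mem_cube rq ->]]].
  by exists (mquot q a, mrem q a); rewrite /= mquot_cube // mrem_cube // mcomb_divmod.
apply/mem_cube => t; rewrite mcombE; have := gm t; have := rq t.
by move=> rqt gmt; apply: (@leq_trans ((g t).+1 * q)); rewrite ?leq_mul2r //; nia.
Qed.

(** A bound on the degree in each variable separately, the notion that decides
membership in a box and adds up under products. *)
Definition supp_le d (p : poly) := forall a, a \in msupp p -> forall t, (a t <= d)%N.

Lemma supp_leM d e p1 p2 : supp_le d p1 -> supp_le e p2 -> supp_le (d + e) (p1 * p2).
Proof.
move=> p1d p2e a /msuppM_le/allpairsP[[a1 a2] /= [/p1d a1d /p2e a2e ->]] t.
by rewrite mnmDE leq_add.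
Qed.

Lemma supp_leX d p n : supp_le d p -> supp_le (n * d) (p ^+ n).
Proof.
move=> pd; elim: n => [|n IH]; last by rewrite exprS mulSn; exact: supp_leM.
by move=> a; rewrite expr0 msupp1 inE => /eqP -> t; rewrite mnm0E.
Qed.

Lemma supp_leXm d (a : multinom s) : (forall t, a t <= d)%N -> supp_le d (mpolyX C a).
Proof. by move=> ad b; rewrite msuppX inE => /eqP ->. Qed.

(** The degree in each variable is at most q (m - 1) + q - 1 < q m, so these
products do not leave the cube of side q m. *)
Lemma monic_at_comb m q N (g r : multinom s) (p : poly) :
    (0 < m)%N -> (0 < q)%N -> (q * m <= N)%N ->
    monic_at (cube m) g p -> r \in box_monomials (cube q) ->
  monic_at (cube N) (mcomb q g r) (p ^+ q * mpolyX C r).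
Proof.
move=> m0 q0 qmN [pg pg1 pm] /mem_cube rq.
have p0 : p != 0 by apply/eqP => p0; move: pg1; rewrite p0 mcoeff0 => /esym/eqP; rewrite oner_eq0.
have lX : mlead (p ^+ q) = mnm_muln g q by rewrite mleadX // pg.
have Xr0 : mpolyX C r != 0.
  by apply/eqP => Xr; have := mcoeffX C r r; rewrite Xr mcoeff0 eqxx => /esym/eqP; rewrite oner_eq0.
split.
- by rewrite mleadM ?expf_neq0 // lX mleadXm.
- rewrite /mcomb -lX -[X in mnm_add _ X](mleadXm C) mleadcM mleadXm mcoeffX eqxx mulr1.
  by rewrite lX -pg mleadcX pg pg1 expr1n.
- move=> a am; apply/mem_cube => t.
  have pd : supp_le m.-1 p by move=> b /pm/mem_cube bm u; rewrite -ltnS prednK.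
  have rd : supp_le q.-1 (mpolyX C r).
    by apply: supp_leXm => u; rewrite -ltnS prednK.
  have at_le := supp_leM (@supp_leX m.-1 p q pd) rd am t.
  apply: leq_trans qmN; apply: (leq_ltn_trans at_le); nia.
Qed.

Variables (c : R) (L : set 'rV[C]_s).
Hypothesis Lc : bounded_by c L.

(** The polynomials p_g^q z^r have norm at most b_g^q c^(s q), and each b_g occurs
for the q^s choices of r, which gives the exponent q^(s+1).  The exponents outside
the cube of side q m are filled with monomials, of norm at most c^(s N). *)
Lemma vmax_cube_growth m q N : (0 < m)%N -> (0 < q)%N -> (q * m <= N)%N ->
  vmax L (cube N) <=
  (N ^ s)`!%:R * vmax L (cube m) ^+ (q ^ s.+1) *
  (2 * c ^+ s) ^+ (q ^ s.+1 * m ^ s + N * (N ^ s - (q * m) ^ s)).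
Proof.
move=> m0 q0 qmN; have [T [b [Tmon b0 Tb bV]]] := chebyshev_polynomials (cube m) Lc.
have c1 := Lc.1; have c0 : 0 <= c by exact: le_trans c1.
have cs1 : 1 <= c ^+ s by exact: exprn_ege1.
pose inner a := a \in box_monomials (cube (q * m)).
pose T' a := if inner a then T (mquot q a) ^+ q * mpolyX C (mrem q a) else mpolyX C a.
pose b' a := if inner a then (b (mquot q a) * c ^+ s) ^+ q else (c ^+ s) ^+ N.
have b'0 a : 0 <= b' a.
  by rewrite /b'; case: ifP => _; rewrite !exprn_ge0 ?mulr_ge0 ?exprn_ge0.
have T'mon a : a \in box_monomials (cube N) -> monic_at (cube N) a (T' a).
  move=> aN; rewrite /T'; case: ifP => ain.
    rewrite -[X in monic_at _ X](mcomb_divmod q a).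
    by apply: (monic_at_comb m0) => //; [apply: Tmon; exact: mquot_cube | exact: mrem_cube].
  by split; [rewrite mleadXm | rewrite mcoeffX eqxx | move=> d; rewrite msuppX inE => /eqP ->].
have T'b a z : a \in box_monomials (cube N) -> L z -> normc (meval (z 0) (T' a)) <= b' a.
  move=> aN Lz; rewrite /T' /b'; case: ifP => ain.
    rewrite mevalM rmorphXn modulusM modulusX exprMn mevalX /=.
    apply: ler_pM; rewrite ?exprn_ge0 ?modulus_ge0 //.
      by rewrite lerXn2r ?nnegrE ?modulus_ge0 // Tb // mquot_cube.
    apply: le_trans (mono_le _ Lc Lz) _; rewrite -exprM.
    by apply: ler_weXn2l => //; apply: mdeg_cube_le; exact: mrem_cube.
  rewrite mevalX; apply: le_trans (mono_le _ Lc Lz) _; rewrite -exprM.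
  by apply: ler_weXn2l => //; exact: mdeg_cube_le.
have pE : perm_eq [seq a <- box_monomials (cube N) | inner a]
                  (box_monomials (cube (q * m))).
  apply: uniq_perm; rewrite ?filter_uniq ?box_monomials_uniq // => a.
  by rewrite mem_filter andb_idr // => /(mem_cube_sub qmN).
have := vmax_monic_le T'mon b'0 T'b; rewrite box_size_cube => /le_trans; apply.
rewrite -mulrA ler_wpM2l //.
rewrite (bigID inner) /=.
have -> : \prod_(a <- box_monomials (cube N) | inner a) b' a =
    (\prod_(g <- box_monomials (cube m)) b g) ^+ (q ^ s.+1) *
    (c ^+ s) ^+ (q ^ s.+1 * m ^ s).
  rewrite -big_filter (perm_big _ pE) /=.
  under eq_big_seq => a ain do rewrite /b' /inner ain.
  rewrite (perm_big _ (cube_perm m q0)) big_allpairs_dep /=.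
  rewrite (eq_big_seq (fun g => (b g * c ^+ s) ^+ (q * q ^ s))); last first.
    move=> g gm; rewrite (eq_big_seq (fun=> (b g * c ^+ s) ^+ q)); last first.
      by move=> r rq; rewrite mquot_comb.
    by rewrite big_const_seq count_predT iter_mulr_1 size_box_monomials box_size_cube -exprM.
  rewrite -expnS prodrXl big_split exprMn /=; congr (_ * _).
  rewrite big_const_seq count_predT iter_mulr_1 size_box_monomials box_size_cube.
  by rewrite -[LHS]exprM mulnC.
have -> : \prod_(a <- box_monomials (cube N) | ~~ inner a) b' a =
    (c ^+ s) ^+ (N * (N ^ s - (q * m) ^ s)).
  rewrite (eq_bigr (fun=> (c ^+ s) ^+ N)); last first.
    by move=> a /negbTE ain; rewrite /b' ain.
  rewrite big_const_seq iter_mulr_1 exprM; congr (_ ^+ _).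
  have := count_predC inner (box_monomials (cube N)).
  rewrite -{1}size_filter (perm_size pE) !size_box_monomials !box_size_cube => <-.
  by rewrite addKn.
rewrite box_size_cube in bV.
have E1 : (\prod_(g <- box_monomials (cube m)) b g) ^+ (q ^ s.+1) <=
    2 ^+ (q ^ s.+1 * m ^ s) * vmax L (cube m) ^+ (q ^ s.+1).
  rewrite mulnC exprM -exprMn lerXn2r ?nnegrE ?prodr_ge0 //.
  by rewrite mulr_ge0 ?exprn_ge0 ?vmax_ge0.
rewrite -mulrA; apply: le_trans (ler_wpM2r _ E1) _.
  by rewrite mulr_ge0 ?exprn_ge0.
rewrite [X in X * _]mulrC -mulrA ler_wpM2l ?exprn_ge0 ?vmax_ge0 //.
rewrite mulrA -exprMn exprD ler_wpM2l ?exprn_ge0 ?mulr_ge0 ?exprn_ge0 //.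
rewrite lerXn2r ?nnegrE ?mulr_ge0 ?exprn_ge0 //.
by rewrite ler_peMl ?exprn_ge0 // ler1n.
Qed.

End Growth.

(** * Limits of real powers *)

Section RealLimits.
Variable R : realType.

(** Unlike continuity of [powR] at positive points, this includes the limit 0 of
the base, needed for sets of transfinite diameter 0. *)
Lemma cvg_powR (T : Type) (F : set_system T) (FF : ProperFilter F)
    (b p : T -> R) (b0 p0 : R) :
    (forall x, 0 <= b x) -> 0 < p0 ->
    b x @[x --> F] --> b0 -> p x @[x --> F] --> p0 ->
  b x `^ p x @[x --> F] --> b0 `^ p0.
Proof.
move=> bge0 p0gt0 bF pF.
have b00 : 0 <= b0.
  by apply: cvgr_to_ge bF _; near=> x; exact: bge0.
have [b0E|b0n0] := eqVneq b0 0; last first.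
  have b0gt0 : 0 < b0 by rewrite lt_def b0n0.
  have bgt0 : \forall x \near F, 0 < b x by exact: (cvgr_gt _ bF).
  rewrite {2}/powR (negbTE b0n0).
  apply: (@cvg_trans _ (expR (p x * ln (b x)) @[x --> F])).
    apply: near_eq_cvg; near=> x.
    have bx : 0 < b x by near: x.
    by rewrite /powR gt_eqF.
  apply: (cvg_comp (fun x => p x * ln (b x)) expR); last exact: continuous_expR.
  by apply: cvgM => //; apply: (cvg_comp b (@ln R)) bF _; exact: continuous_ln.
rewrite {}b0E in bF *; rewrite powR0 ?gt_eqF //.
apply/cvgrPdist_le => e e0.
have e10 : 0 < Num.min 1 (e `^ (p0 / 2)^-1) by rewrite lt_min ltr01 powR_gt0.
have p20 : p0 / 2 < p0 by rewrite ltr_pdivrMr // ltr_pMr // ltr1n.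
near=> x; rewrite sub0r normrN ger0_norm ?powR_ge0 //.
have bx : b x < Num.min 1 (e `^ (p0 / 2)^-1).
  by near: x; exact: (cvgr_lt _ bF).
have px : p0 / 2 <= p x by near: x; exact: (cvgr_ge _ pF).
have px0 : 0 < p x by apply: lt_le_trans px; rewrite divr_gt0.
have [->|bxn0] := eqVneq (b x) 0; first by rewrite powR0 ?gt_eqF // ltW.
move: bx; rewrite lt_min => /andP[bx1 bxe].
have -> : e = (e `^ (p0 / 2)^-1) `^ (p0 / 2).
  by rewrite -powRrM mulVf ?powRr1 1?ltW // gt_eqF // divr_gt0.
apply: le_trans (ger_powR _ px) _; first by rewrite lt_def bxn0 bge0 ltW.
by rewrite ge0_ler_powR ?nnegrE ?bge0 ?powR_ge0 ?divr_ge0 // ltW.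
Unshelve. all: by end_near. Qed.

(** Comes from 1 + x <= (1 + e x / 2)^2 <= exp (e x). *)
Lemma ln_le_linear (e x : R) : 0 < e -> 4 / e ^+ 2 <= x -> ln (x + 1) <= e * x.
Proof.
move=> e0 ex; have x0 : 0 < x by apply: lt_le_trans ex; rewrite divr_gt0 ?exprn_gt0.
rewrite -[leRHS]expRK ler_ln ?posrE ?expR_gt0 ?addr_gt0 //.
apply: (@le_trans _ _ ((1 + e * x / 2) ^+ 2)).
  rewrite ler_pdivrMr ?exprn_gt0 // in ex.
  have : 0 <= x * (x * e ^+ 2 - 4) by rewrite mulr_ge0 ?subr_ge0 // ltW.
  nra.
have -> : e * x = (e * x / 2) * 2%:R by rewrite divfK.
rewrite expRM_natr mulfK // lerXn2r ?nnegrE ?expR_ge0 ?expR_ge1Dx //.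
by rewrite addr_ge0 // divr_ge0 // mulr_ge0 // ltW.
Qed.

Lemma cvg_ln_over : ln (x + 1) / x @[x --> +oo] --> (0 : R).
Proof.
apply/cvgrPdist_le => e e0; near=> x.
have x0 : 0 < x by near: x; exact: nbhs_pinfty_gt.
have ex : 4 / e ^+ 2 <= x by near: x; apply: nbhs_pinfty_ge; rewrite num_real.
rewrite sub0r normrN ger0_norm; last first.
  by rewrite divr_ge0 ?ln_ge0 ?lerDr // ltW.
by rewrite ler_pdivrMr // ln_le_linear.
Unshelve. all: by end_near. Qed.

Lemma cvg_root_poly (a : R) (r : nat) : 0 < a ->
  (a * (x + 1) ^+ r) `^ (2 / x) @[x --> +oo] --> (1 : R).
Proof.
move=> a0; suff : (a * (x + 1) ^+ r) `^ (2 / x) @[x --> +oo] --> expR 0 by rewrite expR0.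
apply: (@cvg_trans _ (expR (2 * (ln a * x^-1 + r%:R * (ln (x + 1) / x))) @[x --> +oo])).
  apply: near_eq_cvg; near=> x.
  have x0 : 0 < x by near: x; exact: nbhs_pinfty_gt.
  have x10 : 0 < x + 1 by rewrite addr_gt0.
  rewrite /powR gt_eqF ?mulr_gt0 ?exprn_gt0 //; congr expR.
  rewrite lnM ?posrE ?exprn_gt0 // lnXn // -mulr_natl.
  by rewrite mulrDr mulrDr; congr (_ + _); ring.
apply: (cvg_comp _ expR); last exact: continuous_expR.
have -> : 0 = 2 * (ln a * 0 + r%:R * 0) :> R by rewrite !mulr0 addr0 mulr0.
apply: cvgMl_tmp; apply: cvgD; apply: cvgMl_tmp; last exact: cvg_ln_over.
apply/gtr0_cvgV0; last exact: cvg_id.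
exact: nbhs_pinfty_gt.
Unshelve. all: by end_near. Qed.


Lemma sup_powR (E : set R) (a : R) :
    0 <= a -> E !=set0 \/ a != 0 -> has_ubound E -> (forall x, E x -> 0 <= x) ->
  sup [set x `^ a | x in E] = sup E `^ a.
Proof.
move=> a0 Ea Eub E0; have [aE|an0] := eqVneq a 0.
  rewrite {}aE in Ea *; case: Ea => [[x Ex]|]; last by rewrite eqxx.
  rewrite powRr0; have -> : [set x `^ 0 | x in E] = [set (1 : R)].
    apply/seteqP; split=> [_ [y _ <-]|_ ->]; rewrite /= ?powRr0 //.
    by exists x; rewrite ?powRr0.
  exact: sup1.
have agt0 : 0 < a by rewrite lt_def an0.
have [[x Ex]|nE] := pselect (E !=set0); last first.
  have -> : E = set0 by apply/seteqP; split=> // y Ey; case: nE; exists y.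
  by rewrite image_set0 sup0 powR0.
have supE : has_sup E by split; [exists x|].
have s0 : 0 <= sup E by apply: le_trans (ub_le_sup Eub Ex); exact: E0.
apply/eqP; rewrite eq_le; apply/andP; split.
  apply: ge_sup; first by exists (x `^ a), x.
  move=> _ [y Ey <-]; apply: ge0_ler_powR; rewrite ?nnegrE //; [exact: E0 | exact: ub_le_sup].
have ub : ubound [set x `^ a | x in E] (sup E `^ a).
  move=> _ [y Ey <-]; apply: ge0_ler_powR; rewrite ?nnegrE //; [exact: E0 | exact: ub_le_sup].
set W := (X in _ <= X).
have EW y : E y -> y `^ a <= W.
  by move=> Ey; apply: ub_le_sup; [exists (sup E `^ a) | exists y].
have W0 : 0 <= W by apply: le_trans (EW _ Ex); exact: powR_ge0.
have -> : W = (W `^ a^-1) `^ a by rewrite -powRrM mulVf ?powRr1.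
rewrite ge0_ler_powR ?nnegrE ?powR_ge0 //; apply: ge_sup; first by exists x.
move=> y Ey; have -> : y = (y `^ a) `^ a^-1.
  by rewrite -powRrM mulfV // powRr1 // E0.
by apply: ge0_ler_powR; rewrite ?nnegrE ?powR_ge0 ?invr_ge0 //; exact: EW.
Qed.

(** Let l be the infimum of the [g n].  The upper bounds [U] give limsup x <= l,
while g n >= l solved for [x n] gives x n >= (l / rho n)^(1 / theta n), which tends
to l.  The parameter [n0] discards the indices where [theta] vanishes. *)
Lemma cvg_of_limsup_bounds (x g rho theta : nat -> R) (n0 : nat) :
    (forall n, 0 <= x n) -> (forall n, 0 < rho n) -> (forall n, (n0 <= n)%N -> 0 < theta n) ->
    rho n @[n --> \oo] --> (1 : R) -> theta n @[n --> \oo] --> (1 : R) ->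
    (forall n, (n0 <= n)%N -> g n = x n `^ theta n * rho n) ->
    (forall n, (n0 <= n)%N -> exists U : nat -> R,
       U N @[N --> \oo] --> g n /\ \forall N \near \oo, x N <= U N) ->
  cvg (x n @[n --> \oo]).
Proof.
move=> x0 rho0 theta0 rho1 theta1 gE xU.
have g0 n : (n0 <= n)%N -> 0 <= g n.
  by move=> nn; rewrite gE // mulr_ge0 ?powR_ge0 // ltW.
set E := [set g n | n in [set n | (n0 <= n)%N]].
have Einf : has_inf E.
  by split; [exists (g n0), n0 => //=| exists 0 => _ [n nn <-]; exact: g0].
set l := inf E.
have l0 : 0 <= l by apply: lb_le_inf => [|_ [n nn <-]]; [exact: Einf.1|exact: g0].
pose lower n := (l / rho n) `^ (theta n)^-1.
have lowerP : lower n @[n --> \oo] --> l.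
  have H : lower n @[n --> \oo] --> (l * 1^-1) `^ 1^-1.
    apply: cvg_powR; rewrite ?invr1 //.
    - by move=> n; rewrite divr_ge0 // ltW.
    - by rewrite -[X in _ --> l * X]invr1; apply: cvgMl_tmp; apply: cvgV => //; exact: oner_neq0.
    - by rewrite -[X in _ --> X]invr1; apply: cvgV => //; exact: oner_neq0.
  by rewrite invr1 mulr1 powRr1 in H.
apply: (cvgP l); apply/cvgrPdist_le => e e0.
have [_ [m mm <-] gm] : exists2 y, E y & y < l + e.
  exact: inf_adherent.
have [U [Um xUm]] := xU m mm.
near=> n.
rewrite distrC ler_distl; apply/andP; split.
  apply: (@le_trans _ _ (lower n)).
    by near: n; apply: (cvgr_ge _ lowerP); rewrite ltrBlDr ltrDl.
  have nn : (n0 <= n)%N by near: n; exact: nbhs_infty_ge.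
  have -> : x n = (x n `^ theta n) `^ (theta n)^-1.
    by rewrite -powRrM mulfV ?powRr1 // gt_eqF // theta0.
  have tn := theta0 n nn.
  rewrite ge0_ler_powR ?nnegrE ?powR_ge0 ?divr_ge0 ?invr_ge0 //; do ?exact: ltW.
  rewrite ler_pdivrMr // -gE //; apply: ge_inf; first exact: Einf.2.
  by exists n.
apply: (@le_trans _ _ (U n)); first by near: n.
by near: n; exact: (cvgr_le _ Um).
Unshelve. all: by end_near. Qed.

End RealLimits.

(** * Normalized Vandermonde suprema of product sets *)

Section CubeDiameter.
Variable R : realType.
Local Notation C := (Cplx R).

(** Compactness is used in its near-covering form: each point has a neighbourhood
on which all sufficiently large constants are bounds. *)
Lemma compact_bounded_by s (L : set 'rV[C]_s) :
  compact L -> exists c, bounded_by c L.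
Proof.
move=> /compact_near_coveringP cL.
have nearL : \forall c \near +oo%R, L `<=` [set z | forall t, normc (z 0 t) <= c].
  apply: (cL R (pinfty_nbhs R) (fun c z => forall t, normc (z 0 t) <= c)) => z Lz.
  pose c0 := \sum_t normc (z 0 t) + 1.
  exists (ball z (1 : C), [set c | c0 <= c]).
    split; first by apply: nbhsx_ballx; exact: ltr01.
    by apply: nbhs_pinfty_ge; rewrite num_real.
  move=> [y c] /= [[_ zy] c0c] t; apply: le_trans c0c.
  have := zy 0 t; rewrite -ball_normE /= => zyt.
  have {}zyt : normc (z 0 t - y 0 t) < 1.
    by move: zyt; rewrite normc_def ltcE /= => /andP[_]; rewrite /normc; case: (z 0 t - y 0 t).
  have -> : y 0 t = z 0 t + - (z 0 t - y 0 t) by rewrite opprB addrC subrK.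
  apply: le_trans (modulusD _ _) _.
  have -> : normc (- (z 0 t - y 0 t)) = normc (z 0 t - y 0 t) by exact: normcN.
  apply: lerD; last exact: ltW.
  by rewrite (bigD1 t) //= lerDl sumr_ge0 // => i _; exact: modulus_ge0.
have [c [cL1 c1]] : exists c : R, L `<=` [set z | forall t, normc (z 0 t) <= c] /\ 1 <= c.
  near (pinfty_nbhs R) => c; exists c; split; first by near: c.
  by near: c; apply: nbhs_pinfty_ge; rewrite num_real.
by exists c; split.
Unshelve. all: by end_near. Qed.

(** With [box_size N] the only datum of the box on which the degree depends. *)
Definition excess s (N : 'I_s -> nat) : R := \sum_t ((N t)%:R - 1).
Definition vdet_degree s (N : 'I_s -> nat) : R := (box_size N)%:R * (excess N / 2).
(** Covers at once the cubes of side n and the boxes of sides [wbox w n]. *)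
Definition cdiam s (L : set 'rV[C]_s) (N : 'I_s -> nat) : R :=
  vmax L N `^ (vdet_degree N)^-1.

Lemma excess_ge0 s (N : 'I_s -> nat) : (forall t, 2 <= N t)%N -> 0 <= excess N.
Proof.
by move=> N2; apply: sumr_ge0 => t _; rewrite subr_ge0 ler1n (leq_trans _ (N2 t)).
Qed.

Lemma excess_gt0 s (N : 'I_s -> nat) : (0 < s)%N -> (forall t, 2 <= N t)%N ->
  0 < excess N.
Proof.
case: s N => // s N _ N2; rewrite /excess big_ord_recl ltr_pwDl //.
  by rewrite subr_gt0 ltr1n.
by apply: sumr_ge0 => t _; rewrite subr_ge0 ler1n (leq_trans _ (N2 _)).
Qed.

Lemma box_size_gt0_ge2 s (N : 'I_s -> nat) : (forall t, 2 <= N t)%N -> (0 < box_size N)%N.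
Proof. by move=> N2; apply: box_size_gt0 => t; exact: leq_trans (N2 t). Qed.

Lemma vdet_degree_gt0 s (N : 'I_s -> nat) : (0 < s)%N -> (forall t, 2 <= N t)%N ->
  0 < vdet_degree N.
Proof.
by move=> s0 N2; rewrite mulr_gt0 ?ltr0n ?box_size_gt0_ge2 // divr_gt0 ?excess_gt0.
Qed.

Lemma det_degree_vdetE s (N : 'I_s -> nat) : (forall t, 2 <= N t)%N ->
  (det_degree R N)%:R = vdet_degree N.
Proof.
move=> N2; rewrite det_degreeE => [|t]; last exact: leq_trans (N2 t).
by rewrite -mulr_suml.
Qed.

(** In dimension 0 the determinant is that of the 1 by 1 matrix with entry 1. *)
Lemma vmax_dim0 (L : set 'rV[C]_0) (N : 'I_0 -> nat) : L !=set0 -> vmax L N = 1.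
Proof.
move=> [z Lz]; rewrite /vmax.
suff -> : [set normc (\det (vandermonde z))
   | z in [set z : 'M[C]_(box_size N, 0) | forall i, L (row i z)]] = [set (1 : R)].
  exact: sup1.
have b1 : box_size N = 1%N by rewrite /box_size big_ord0.
have det1 (z' : 'M[C]_(box_size N, 0)) : normc (\det (vandermonde z')) = 1.
  have -> : vandermonde z' = const_mx 1.
    by apply/matrixP => i j; rewrite !mxE big_ord0.
  suff -> : \det (const_mx 1 : 'M[C]_(box_size N)) = 1 by exact: modulus1.
  by rewrite b1 det_mx11 mxE.
apply/seteqP; split=> [_ [z' _ <-]|_ ->]; first exact: det1.
exists 0 => [i|]; last exact: det1.
by have -> : row i (0 : 'M[C]_(_, 0)) = z by apply/rowP; case.
Qed.

Lemma sup_vandermondeE s c (L : set 'rV[C]_s) (N : 'I_s -> nat) :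
    bounded_by c L -> (s = 0%N -> L !=set0) -> (forall t, 2 <= N t)%N ->
  sup_vandermonde L N (vdet_degree N) = cdiam L N.
Proof.
move=> Lc L0 N2; rewrite /sup_vandermonde /cdiam /vmax.
set A := [set z | _]; set f := fun z => normc (\det (vandermonde z)).
rewrite -(sup_powR (E := f @` A)).
- by rewrite image_comp.
- by rewrite invr_ge0 mulr_ge0 // divr_ge0 // excess_ge0.
- have [s0|s0] := eqVneq s 0%N.
    left; have [z Lz] := L0 s0; exists (f (\matrix_i z)), (\matrix_i z) => // i.
    by rewrite rowK.
  by right; rewrite invr_neq0 // gt_eqF // vdet_degree_gt0 // lt0n.
- exact: vmax_has_ubound Lc.
- by move=> _ [z _ <-]; exact: modulus_ge0.
Qed.

Lemma leq_fact_exp n : (n`! <= n ^ n)%N.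
Proof.
elim: n => // n IH; rewrite factS expnS leq_mul2l /=.
by apply: leq_trans IH _; case: n => // n; rewrite leq_exp2r.
Qed.

(** The bound M! 4^M <= (4 M)^M with M <= (1 + sum (N_t - 1))^s makes the base
polynomial in [excess N], while the root has order M * excess N / 2. *)
Lemma factorial_root_le s (N : 'I_s -> nat) : (0 < s)%N -> (forall t, 2 <= N t)%N ->
  ((box_size N)`!%:R * 4 ^+ box_size N) `^ (vdet_degree N)^-1 <=
  (4 * (excess N + 1) ^+ s) `^ (2 / excess N).
Proof.
move=> s0 N2; set M := box_size N; set S := excess N.
have S0 : 0 < S by exact: excess_gt0.
have M0 : 0 < M%:R :> R by rewrite ltr0n box_size_gt0_ge2.
have MS : M%:R <= (S + 1) ^+ s.
  rewrite /M /box_size natr_prod -[s in leRHS]card_ord -prodr_const.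
  apply: ler_prod => t _; rewrite ler0n /= /S /excess (bigD1 t) //= addrAC subrK.
  by rewrite lerDl sumr_ge0 // => i _; rewrite subr_ge0 ler1n (leq_trans _ (N2 i)).
have E : M`!%:R * 4 ^+ M <= (4 * M%:R) ^+ M :> R.
  by rewrite mulrC exprMn ler_wpM2l ?exprn_ge0 // -natrX ler_nat leq_fact_exp.
have D0 : 0 < vdet_degree N by exact: vdet_degree_gt0.
apply: (@le_trans _ _ (((4 * M%:R) ^+ M) `^ (vdet_degree N)^-1)).
  by rewrite ge0_ler_powR ?nnegrE ?invr_ge0 ?mulr_ge0 ?exprn_ge0 ?mulr_ge0 // ltW.
rewrite -powR_mulrn ?mulr_ge0 // -powRrM.
have -> : M%:R * (vdet_degree N)^-1 = 2 / S.
  by rewrite /vdet_degree -/M -/S; field; rewrite !gt_eqF.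
apply: ge0_ler_powR; rewrite ?nnegrE.
- by rewrite divr_ge0 // ltW.
- by rewrite mulr_ge0.
- by rewrite mulr_ge0 // exprn_ge0 // addr_ge0 // ltW.
- by rewrite ler_pM2l.
Qed.

(** The D-th root of v1^M2, with D = M1 M2 S / 2 the degree for the product box, is
expressed through the normalized supremum of the factor.  In dimension 0 the degree
of the factor vanishes, but then the determinant is 1. *)
Lemma cdiam_expE s (L : set 'rV[C]_s) (N : 'I_s -> nat) (n : nat) (S : R) :
    (s = 0%N -> L !=set0) -> (forall t, 2 <= N t)%N -> (0 < n)%N -> 0 < S ->
  (vmax L N ^+ n) `^ ((box_size N * n)%:R * (S / 2))^-1 =
  cdiam L N `^ (excess N / S).
Proof.
move=> L0 N2 n0 S0; rewrite /cdiam.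
have [s0|s0] := posnP s.
  by subst s; rewrite (vmax_dim0 N (L0 erefl)) expr1n !powR1.
have e0 := excess_gt0 s0 N2; have M0 := box_size_gt0_ge2 N2.
rewrite -powR_mulrn ?vmax_ge0 // -!powRrM natrM /vdet_degree; congr (_ `^ _).
by field; rewrite !gt_eqF // ltr0n.
Qed.

Section Product.
Variables (k l : nat) (K1 : set 'rV[C]_k) (K2 : set 'rV[C]_l) (c : R).
Hypotheses (bK1 : bounded_by c K1) (bK2 : bounded_by c K2).
Hypotheses (K1pt : k = 0%N -> K1 !=set0) (K2pt : l = 0%N -> K2 !=set0).
Hypothesis kl0 : (0 < k + l)%N.

Lemma cdiam_prod_bounds (N : 'I_(k + l) -> nat)
    (N1 := fun t => N (lshift l t)) (N2 := fun t => N (rshift k t))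
    (A := cdiam K1 N1 `^ (excess N1 / excess N) * cdiam K2 N2 `^ (excess N2 / excess N)) :
    (forall t, 2 <= N t)%N ->
  A <= cdiam (prod_set K1 K2) N <=
  (4 * (excess N + 1) ^+ (k + l)) `^ (2 / excess N) * A.
Proof.
move=> NN; have N1N t : (2 <= N1 t)%N by exact: NN.
have N2N t : (2 <= N2 t)%N by exact: NN.
have S0 := excess_gt0 kl0 NN; have D0 := vdet_degree_gt0 kl0 NN.
have M1 := box_size_gt0_ge2 N1N; have M2 := box_size_gt0_ge2 N2N.
have MM : box_size N = (box_size N1 * box_size N2)%N by rewrite /box_size big_split_ord.
have -> : A = (vmax K1 N1 ^+ box_size N2 * vmax K2 N2 ^+ box_size N1) `^ (vdet_degree N)^-1.
  rewrite powRM ?exprn_ge0 ?vmax_ge0 // /A; congr (_ * _).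
    by rewrite /vdet_degree MM (cdiam_expE K1pt N1N M2 S0).
  by rewrite /vdet_degree MM mulnC (cdiam_expE K2pt N2N M1 S0).
set B := _ * _; have B0 : 0 <= B by rewrite mulr_ge0 ?exprn_ge0 ?vmax_ge0.
apply/andP; split.
  rewrite ge0_ler_powR ?nnegrE ?vmax_ge0 ?invr_ge0 ?(ltW D0) //.
  exact: (vmax_prod_ge_sup bK1 bK2).
apply: (@le_trans _ _ (((box_size N)`!%:R * 4 ^+ box_size N * B) `^ (vdet_degree N)^-1)).
  rewrite ge0_ler_powR ?nnegrE ?vmax_ge0 ?invr_ge0 ?(ltW D0) //.
    by rewrite mulr_ge0 // mulr_ge0 // exprn_ge0.
  exact: (vmax_prod_le N bK1 bK2).
rewrite [leLHS]powRM //; apply: ler_wpM2r; first exact: powR_ge0.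
exact: factorial_root_le.
Qed.

(** Stated for an arbitrary sequence of boxes so that it applies to the cubes and
to the weighted boxes along the multiples of the common denominator.  The exponents
are positive unless the factor has dimension 0, in which case its contribution is
constantly 1. *)
Lemma cdiam_prod_cvg (F : set_system nat) (FF : ProperFilter F)
    (Nf : nat -> 'I_(k + l) -> nat) (p1 p2 d1 d2 : R)
    (N1 := fun n t => Nf n (lshift l t)) (N2 := fun n t => Nf n (rshift k t)) :
    (\forall n \near F, forall t, (2 <= Nf n t)%N) ->
    excess (Nf n) @[n --> F] --> +oo ->
    excess (N1 n) / excess (Nf n) @[n --> F] --> p1 ->
    excess (N2 n) / excess (Nf n) @[n --> F] --> p2 ->
    ((0 < k)%N -> 0 < p1) -> ((0 < l)%N -> 0 < p2) ->
    cdiam K1 (N1 n) @[n --> F] --> d1 -> cdiam K2 (N2 n) @[n --> F] --> d2 ->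
  cdiam (prod_set K1 K2) (Nf n) @[n --> F] --> d1 `^ p1 * d2 `^ p2.
Proof.
move=> N2F Sy p1F p2F p10 p20 d1F d2F.
have factor s (L : set 'rV[C]_s) (N' : nat -> 'I_s -> nat) p d :
    excess (N' n) / excess (Nf n) @[n --> F] --> p -> ((0 < s)%N -> 0 < p) ->
    cdiam L (N' n) @[n --> F] --> d ->
    cdiam L (N' n) `^ (excess (N' n) / excess (Nf n)) @[n --> F] --> d `^ p.
  move=> pF p0 dF; have [s0|s0] := posnP s.
    have ex0 n : excess (N' n) = 0 by subst s; rewrite /excess big_ord0.
    have -> : p = 0.
      apply: (norm_cvg_unique pF); apply: cvg_near_cst; apply: nearW => n.
      by rewrite ex0 mul0r.
    rewrite powRr0; apply: cvg_near_cst; apply: nearW => n.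
    by rewrite ex0 mul0r powRr0.
  by apply: cvg_powR => //; [move=> n; exact: powR_ge0 | exact: p0].
have FF' : Filter F by exact: filter_filter.
have AF := @cvgM _ _ _ FF' _ _ _ _ (factor _ _ _ _ _ p1F p10 d1F) (factor _ _ _ _ _ p2F p20 d2F).
have hF : (4 * (excess (Nf n) + 1) ^+ (k + l)) `^ (2 / excess (Nf n)) @[n --> F] --> (1 : R).
  apply: (cvg_comp _ (fun x : R => (4 * (x + 1) ^+ (k + l)) `^ (2 / x)) Sy).
  exact: cvg_root_poly.
have BF := @cvgM _ _ _ FF' _ _ _ _ hF AF; rewrite mul1r in BF.
apply: (squeeze_cvgr _ AF BF).
by near=> n; apply: cdiam_prod_bounds; near: n.
Unshelve. all: by end_near. Qed.

End Product.
End CubeDiameter.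

(** * Existence of the transfinite diameter *)

Section Existence.
Variable R : realType.
Local Notation C := (Cplx R).
Local Notation cube s n := (fun _ : 'I_s => n).

Lemma excess_cube s n : excess R (cube s n) = s%:R * (n%:R - 1).
Proof. by rewrite /excess sumr_const card_ord mulr_natl. Qed.

Lemma vdet_degree_cube s n : vdet_degree R (cube s n) = s%:R / 2 * n%:R ^+ s * (n%:R - 1).
Proof. by rewrite /vdet_degree box_size_cube excess_cube natrX; field. Qed.

Lemma cvg_natr_inv : (n%:R : R)^-1 @[n --> \oo] --> (0 : R).
Proof.
apply/gtr0_cvgV0; last exact: cvgr_idn.
by near=> n; rewrite ltr0n; near: n; exact: nbhs_infty_gt.
Unshelve. all: by end_near. Qed.

Lemma cvg_natr_subr1 : (n%:R : R) - 1 @[n --> \oo] --> +oo.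
Proof.
apply/cvgryPge => A; near=> n; rewrite lerBrDr.
by near: n; move/cvgryPge: (@cvgr_idn R); apply.
Unshelve. all: by end_near. Qed.

Lemma cvg_div_predn : (n%:R : R) / (n%:R - 1) @[n --> \oo] --> (1 : R).
Proof.
have i0 : ((n%:R : R) - 1)^-1 @[n --> \oo] --> (0 : R).
  apply/gtr0_cvgV0; last exact: cvg_natr_subr1.
  by near=> n; rewrite subr_gt0 ltr1n; near: n; exact: nbhs_infty_gt.
have H : 1 + ((n%:R : R) - 1)^-1 @[n --> \oo] --> (1 + 0 : R).
  by apply: cvgD => //; exact: cvg_cst.
rewrite addr0 in H; apply: cvg_trans H; apply: near_eq_cvg; near=> n.
have n1 : (n%:R : R) - 1 != 0.
  by rewrite gt_eqF // subr_gt0 ltr1n; near: n; exact: nbhs_infty_gt.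
by field.
Unshelve. all: by end_near. Qed.

(** Squeezed between 1/m - 1/n and 1/m. *)
Lemma cvg_divn_ratio (m : nat) : (0 < m)%N ->
  ((n %/ m)%:R : R) / n%:R @[n --> \oo] --> (m%:R^-1 : R).
Proof.
move=> m0; have mp : 0 < m%:R :> R by rewrite ltr0n.
have H : (m%:R^-1 : R) - n%:R^-1 @[n --> \oo] --> (m%:R^-1 - 0 : R).
  by apply: cvgB; [exact: cvg_cst | exact: cvg_natr_inv].
rewrite subr0 in H; apply: (squeeze_cvgr _ H (cvg_cst _)).
near=> n; have n0 : 0 < n%:R :> R by rewrite ltr0n; near: n; exact: nbhs_infty_gt.
apply/andP; split.
  rewrite ler_pdivlMr // mulrBl mulVf ?gt_eqF // lerBlDr -(ler_pM2l mp) mulrA.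
  rewrite mulfV ?gt_eqF // mul1r natr1 -natrM ler_nat.
  by rewrite mulnC ltnW // ltn_ceil.
rewrite ler_pdivrMr // -(ler_pM2l mp) mulrA mulfV ?gt_eqF // mul1r -natrM ler_nat.
by rewrite mulnC leq_divM.
Unshelve. all: by end_near. Qed.

Lemma cvg_exprn (f : nat -> R) (a : R) r :
  f n @[n --> \oo] --> a -> f n ^+ r @[n --> \oo] --> a ^+ r.
Proof. by move=> fa; apply: (cvg_comp f (fun x => x ^+ r) fa); exact: exprn_continuous. Qed.

Variables (s : nat) (L : set 'rV[C]_s) (c : R).
Hypothesis Lc : bounded_by c L.

Lemma tdiam_seqE n : (s = 0%N -> L !=set0) -> (2 <= n)%N ->
  tdiam_seq L n = cdiam L (cube s n).
Proof.
by move=> L0 n2; rewrite /tdiam_seq -vdet_degree_cube (sup_vandermondeE Lc).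
Qed.

Hypothesis s0 : (0 < s)%N.
Let E : R := 2 * c ^+ s.

(** The exponent of [E] in [vmax_cube_growth] for q = n %/ m. *)
Definition growth_exp m n : nat :=
  ((n %/ m) ^ s.+1 * m ^ s + n * (n ^ s - (n %/ m * m) ^ s))%N.

Lemma cdiam_cube_growth m n : (2 <= m)%N -> (m <= n)%N ->
  cdiam L (cube s n) <=
  (4 * (excess R (cube s n) + 1) ^+ s) `^ (2 / excess R (cube s n)) *
  cdiam L (cube s m) `^ (vdet_degree R (cube s m) * (n %/ m)%:R ^+ s.+1 /
                           vdet_degree R (cube s n)) *
  E `^ ((growth_exp m n)%:R / vdet_degree R (cube s n)).
Proof.
move=> m2 mn; have n2 := leq_trans m2 mn; have m0 : (0 < m)%N by exact: leq_trans m2.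
have Dm : 0 < vdet_degree R (cube s m) by exact: vdet_degree_gt0.
have Dn : 0 < vdet_degree R (cube s n) by exact: vdet_degree_gt0.
have c0 : 0 <= c by exact: le_trans Lc.1.
have E0 : 0 <= E by rewrite mulr_ge0 ?exprn_ge0.
have q0 : (0 < n %/ m)%N by rewrite divn_gt0.
have := vmax_cube_growth Lc m0 q0 (leq_divM n m).
rewrite -/E -/(growth_exp m n) -(box_size_cube s n).
set B := (_ * _ * _) => vB.
have B0 : 0 <= B by exact: le_trans (vmax_ge0 _ _) vB.
apply: (@le_trans _ _ (B `^ (vdet_degree R (cube s n))^-1)).
  by rewrite ge0_ler_powR ?nnegrE ?vmax_ge0 ?invr_ge0 ?(ltW Dn).
rewrite /B powRM ?mulr_ge0 ?exprn_ge0 ?vmax_ge0 //.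
rewrite powRM ?exprn_ge0 ?vmax_ge0 // -(powR_mulrn _ E0) -powRrM.
apply: ler_wpM2r; first exact: powR_ge0.
rewrite -(powR_mulrn _ (vmax_ge0 _ _)) -powRrM /cdiam -powRrM.
have -> : (vdet_degree R (cube s m))^-1 *
    (vdet_degree R (cube s m) * (n %/ m)%:R ^+ s.+1 / vdet_degree R (cube s n)) =
    ((n %/ m) ^ s.+1)%:R / vdet_degree R (cube s n).
  by rewrite natrX; field; rewrite !gt_eqF.
apply: ler_wpM2r; first exact: powR_ge0.
apply: le_trans _ (factorial_root_le R s0 (fun=> n2)).
apply: ge0_ler_powR; rewrite ?nnegrE ?invr_ge0 ?(ltW Dn) ?mulr_ge0 ?exprn_ge0 //.
by rewrite ler_peMr // exprn_ege1 // ler1n.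
Qed.

Lemma cvg_degree_ratio m : (2 <= m)%N ->
  vdet_degree R (cube s m) * (n %/ m)%:R ^+ s.+1 / vdet_degree R (cube s n) @[n --> \oo] -->
  ((m%:R - 1) / m%:R : R).
Proof.
move=> m2; have m0 : (0 < m)%N by exact: leq_trans m2.
have mn0 : m%:R != 0 :> R by rewrite pnatr_eq0 -lt0n.
have sn0 : s%:R != 0 :> R by rewrite pnatr_eq0 -lt0n.
have H : m%:R ^+ s * (m%:R - 1) * (((n %/ m)%:R : R) / n%:R) ^+ s.+1 *
    (n%:R / (n%:R - 1)) @[n --> \oo] --> m%:R ^+ s * (m%:R - 1) * (m%:R^-1 : R) ^+ s.+1 * 1.
  apply: cvgM; last exact: cvg_div_predn.
  by apply: cvgMl_tmp; apply: cvg_exprn; exact: cvg_divn_ratio.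
have -> : (m%:R - 1) / m%:R = m%:R ^+ s * (m%:R - 1) * (m%:R^-1 : R) ^+ s.+1 * 1.
  by rewrite exprVn exprS; field; rewrite mn0 expf_neq0.
apply: cvg_trans H; apply: near_eq_cvg; near=> n.
have n2 : (2 <= n)%N by near: n; exact: nbhs_infty_ge.
have nn0 : n%:R != 0 :> R by rewrite pnatr_eq0 -lt0n (leq_trans _ n2).
have n10 : n%:R - 1 != 0 :> R by rewrite gt_eqF // subr_gt0 ltr1n.
rewrite !vdet_degree_cube expr_div_n exprS [in n%:R ^+ s.+1]exprS.
by field; rewrite nn0 n10 sn0 expf_neq0.
Unshelve. all: by end_near. Qed.

Lemma cvg_growth_exp m : (0 < m)%N ->
  (growth_exp m n)%:R / vdet_degree R (cube s n) @[n --> \oo] --> (2 / s%:R / m%:R : R).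
Proof.
move=> m0.
have mn0 : m%:R != 0 :> R by rewrite pnatr_eq0 -lt0n.
have sn0 : s%:R != 0 :> R by rewrite pnatr_eq0 -lt0n.
pose a n : R := (n %/ m)%:R / n%:R.
have ac : a n @[n --> \oo] --> (m%:R^-1 : R) by exact: cvg_divn_ratio.
have H : 2 / s%:R * (n%:R / (n%:R - 1)) *
    (a n ^+ s.+1 * m%:R ^+ s + (1 - (a n * m%:R) ^+ s)) @[n --> \oo] -->
    (2 / s%:R * 1 * (m%:R^-1 ^+ s.+1 * m%:R ^+ s + (1 - (m%:R^-1 * m%:R) ^+ s)) : R).
  apply: cvgM; first by apply: cvgMl_tmp; exact: cvg_div_predn.
  apply: cvgD; first by apply: cvgMr_tmp; exact: cvg_exprn.
  by apply: cvgB; [exact: cvg_cst | apply: cvg_exprn; exact: cvgMr_tmp].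
have -> : 2 / s%:R / m%:R = 2 / s%:R * 1 *
    (m%:R^-1 ^+ s.+1 * m%:R ^+ s + (1 - (m%:R^-1 * m%:R) ^+ s)) :> R.
  rewrite mulVf // expr1n subrr addr0 exprS exprVn.
  by field; rewrite mn0 sn0 expf_neq0.
apply: cvg_trans H; apply: near_eq_cvg; near=> n.
have n2 : (2 <= n)%N by near: n; exact: nbhs_infty_ge.
have nn0 : n%:R != 0 :> R by rewrite pnatr_eq0 -lt0n (leq_trans _ n2).
have n10 : n%:R - 1 != 0 :> R by rewrite gt_eqF // subr_gt0 ltr1n.
rewrite !vdet_degree_cube /growth_exp natrD !natrM natrB; last first.
  by rewrite leq_exp2r // leq_divM.
rewrite !natrX natrM /a !exprMn !exprVn [n%:R ^+ s.+1]exprS.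
by field; rewrite nn0 n10 sn0 expf_neq0.
Unshelve. all: by end_near. Qed.

(** Fekete's argument: in the limit n -> oo the growth inequality bounds
limsup x_n by x_m^((m-1)/m) E^(2 / (s m)), whose exponents tend to 1 and 0. *)
Lemma tdiam_seq_cvg_gt0 : cvg (tdiam_seq L n @[n --> \oo]).
Proof.
have E1 : 1 <= E.
  have c1 := Lc.1; apply: (@le_trans _ _ (c ^+ s)); first exact: exprn_ege1.
  by rewrite /E ler_peMl ?exprn_ge0 ?ler1n // (le_trans ler01).
have E0 : 0 < E by exact: lt_le_trans E1.
pose x n := cdiam L (cube s n).
suff : cvg (x n @[n --> \oo]).
  move=> /cvg_ex[l xl]; apply: (cvgP l); apply: cvg_trans xl.
  apply: near_eq_cvg; near=> n; rewrite /x tdiam_seqE //.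
    by move=> sE; exfalso; move: s0; rewrite sE.
  by near: n; exact: nbhs_infty_ge.
pose theta n : R := (n%:R - 1) / n%:R.
pose rho n : R := E `^ (2 / s%:R / n%:R).
have sgt0 : 0 < s%:R :> R by rewrite ltr0n.
have theta0 n : (2 <= n)%N -> 0 < theta n.
  by move=> n2; rewrite divr_gt0 ?subr_gt0 ?ltr1n // ltr0n (leq_trans _ n2).
apply: (@cvg_of_limsup_bounds _ x (fun n => x n `^ theta n * rho n) rho theta 2) => //.
- by move=> n; exact: powR_ge0.
- by move=> n; exact: powR_gt0.
- have H : 2 / s%:R * (n%:R : R)^-1 @[n --> \oo] --> (2 / s%:R * 0 : R).
    by apply: cvgMl_tmp; exact: cvg_natr_inv.
  have {}H : expR (2 / s%:R * (n%:R : R)^-1 * ln E) @[n --> \oo] --> expR (2 / s%:R * 0 * ln E).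
    apply: (cvg_comp _ expR); last exact: continuous_expR.
    exact: cvgMr_tmp.
  rewrite mulr0 mul0r expR0 in H; apply: cvg_trans H; apply: near_eq_cvg.
  by near=> n; rewrite /rho /powR gt_eqF.
- have H : (n%:R / (n%:R - 1))^-1 @[n --> \oo] --> (1^-1 : R).
    by apply: cvgV; [exact: oner_neq0 | exact: cvg_div_predn].
  rewrite invr1 in H; apply: cvg_trans H; apply: near_eq_cvg.
  by near=> n; rewrite /theta invf_div.
move=> m m2; exists (fun n =>
  (4 * (excess R (cube s n) + 1) ^+ s) `^ (2 / excess R (cube s n)) *
  x m `^ (vdet_degree R (cube s m) * (n %/ m)%:R ^+ s.+1 / vdet_degree R (cube s n)) *
  E `^ ((growth_exp m n)%:R / vdet_degree R (cube s n))); split; last first.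
  by near=> n; apply: cdiam_cube_growth => //; near: n; exact: nbhs_infty_ge.
rewrite -[x m `^ _]mul1r; apply: cvgM; first apply: cvgM.
- apply: (cvg_comp (fun n => excess R (cube s n))
    (fun y : R => (4 * (y + 1) ^+ s) `^ (2 / y))); last exact: cvg_root_poly.
  have -> : (fun n => excess R (cube s n)) = (fun n => s%:R * (n%:R - 1)).
    by apply/funext => n; exact: excess_cube.
  apply/cvgryPge => A; near=> n; rewrite mulrC -ler_pdivrMr //.
  by near: n; move/cvgryPge: cvg_natr_subr1; apply.
- apply: cvg_powR; [by move=> n; exact: powR_ge0 | exact: theta0 | exact: cvg_cst |].
  exact: cvg_degree_ratio.
- apply: cvg_powR; [by move=> _; exact: ltW | | exact: cvg_cst |].
    by rewrite !divr_gt0 // ltr0n (leq_trans _ m2).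
  by apply: cvg_growth_exp; exact: leq_trans m2.
Unshelve. all: by end_near. Qed.

End Existence.

Lemma tdiam_seq_cvg (R : realType) s (L : set 'rV[Cplx R]_s) (c : R) :
  bounded_by c L -> (s = 0%N -> L !=set0) -> cvg (tdiam_seq L n @[n --> \oo]).
Proof.
move=> Lc L0; have [sE|s0] := posnP s; last exact: tdiam_seq_cvg_gt0 Lc s0.
apply: (cvgP (1 : R)); apply: cvg_near_cst; near=> n.
rewrite (tdiam_seqE Lc) //; last by near: n; exact: nbhs_infty_ge.
by subst s; rewrite /cdiam vmax_dim0 ?powR1 //; exact: L0.
Unshelve. all: by end_near. Qed.

(** * Weighted boxes and the theorem *)

Section WeightedBoxes.
Variable R : realType.

Lemma common_den_gt0 s (u : 'rV[rat]_s) : (0 < common_den u)%N.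
Proof.
rewrite /common_den; elim/big_ind: _ => // [m n m0 n0|t _]; first by rewrite lcmn_gt0 m0.
by rewrite absz_gt0 denq_neq0.
Qed.

Lemma denq_dvd_common_den s (u : 'rV[rat]_s) t : (`|denq (u 0%R t)| %| common_den u)%N.
Proof. by rewrite /common_den (bigD1 t) //= dvdn_lcml. Qed.

(** For n divisible by the common denominator, u_t n is a natural number, so the
truncation in [wbox] is exact. *)
Lemma wbox_val s (u : 'rV[rat]_s) n t : 0 < u 0 t -> (common_den u %| n)%N ->
  (wbox u n t)%:R = ratr (u 0 t) * n%:R :> R.
Proof.
move=> ut un.
suff uN : u 0 t * n%:R \is a Num.nat.
  have := truncnK uN; rewrite -/(wbox u n t) => /(congr1 (ratr : rat -> R)).
  by rewrite ratr_nat rmorphM /= ratr_nat.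
have /dvdnP[q nE] := dvdn_trans (denq_dvd_common_den u t) un.
have d0 : 0 < denq (u 0 t) by exact: denq_gt0.
rewrite natrEint mulr_ge0 ?(ltW ut) // andbT.
have -> : u 0 t * n%:R = (numq (u 0 t) * q%:Z)%:~R.
  have dE : (`|denq (u 0%R t)|%N%:R : rat) = (denq (u 0 t))%:~R.
    by rewrite -[in RHS](gtz0_abs d0).
  by rewrite nE natrM dE intrM numqE -mulrA [_ * q%:R]mulrC.
exact: intr_int.
Qed.

Lemma wtdiam_filter_proper s (u : 'rV[rat]_s) : ProperFilter (wtdiam_filter u).
Proof.
apply: Build_ProperFilter_ex => P [N _ NP].
exists (N * common_den u)%N; apply: NP; last exact: dvdn_mull.
by rewrite /= leq_pmulr // common_den_gt0.
Qed.

Lemma wtdiam_filter_infty s (u : 'rV[rat]_s) : wtdiam_filter u --> \oo.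
Proof. exact: cvg_within. Qed.

(** The multiples of the common denominator of all weights are among those for a
part of the weights, so limits along the latter are limits along the former. *)
Lemma wtdiam_filter_sub s s' (u : 'rV[rat]_s) (v : 'rV[rat]_s') :
  (common_den v %| common_den u)%N -> wtdiam_filter u `=>` wtdiam_filter v.
Proof.
move=> vu P; rewrite /wtdiam_filter /within /= => -[N NN NP].
by exists N => // n /NP nP /(dvdn_trans vu); exact: nP.
Qed.

Lemma common_den_lsubmx k l (w : 'rV[rat]_(k + l)) :
  (common_den (lsubmx w) %| common_den w)%N.
Proof.
rewrite /common_den; apply: (big_ind (fun d => d %| _)%N) => [|m n mw nw|t _].
- exact: dvd1n.
- by rewrite dvdn_lcm mw.
- by rewrite mxE; exact: denq_dvd_common_den.
Qed.

Lemma common_den_rsubmx k l (w : 'rV[rat]_(k + l)) :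
  (common_den (rsubmx w) %| common_den w)%N.
Proof.
rewrite /common_den; apply: (big_ind (fun d => d %| _)%N) => [|m n mw nw|t _].
- exact: dvd1n.
- by rewrite dvdn_lcm mw.
- by rewrite mxE; exact: denq_dvd_common_den.
Qed.

Lemma excess_wbox s (u : 'rV[rat]_s) n :
    (forall t, 0 < u 0 t) -> (common_den u %| n)%N ->
  excess R (wbox u n) = ratr (weight u) * n%:R - s%:R.
Proof.
move=> u0 un; rewrite /excess sumrB sumr_const card_ord; congr (_ - _).
rewrite rmorph_sum mulr_suml; apply: eq_bigr => t _; exact: wbox_val.
Qed.

Lemma weight_gt0 s (u : 'rV[rat]_s) : (0 < s)%N -> (forall t, 0 < u 0 t) -> 0 < weight u.
Proof.
case: s u => // s u _ u0; rewrite /weight big_ord_recl ltr_pwDl //.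
by apply: sumr_ge0 => t _; exact: ltW.
Qed.

Lemma wbox_ge2 s (u : 'rV[rat]_s) : (forall t, 0 < u 0 t) ->
  \forall n \near wtdiam_filter u, forall t, (2 <= wbox u n t)%N.
Proof.
move=> u0; have FF := wtdiam_filter_proper u.
apply: filter_forall => t; near=> n.
rewrite -(ler_nat R) wbox_val //; last by near: n; exact: withinT.
rewrite mulrC -ler_pdivrMr ?ltr0q //.
near: n; apply: wtdiam_filter_infty.
by move/cvgryPge: (@cvgr_idn R); apply.
Unshelve. all: by end_near. Qed.

Lemma excess_wbox_cvg s (u : 'rV[rat]_s) : (0 < s)%N -> (forall t, 0 < u 0 t) ->
  excess R (wbox u n) @[n --> wtdiam_filter u] --> +oo.
Proof.
move=> s0 u0; have FF := wtdiam_filter_proper u.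
have W0 : 0 < ratr (weight u) :> R by rewrite ltr0q weight_gt0.
apply/cvgryPge => A; near=> n.
rewrite excess_wbox //; last by near: n; exact: withinT.
rewrite lerBrDr mulrC -ler_pdivrMr //.
near: n; apply: wtdiam_filter_infty.
by move/cvgryPge: (@cvgr_idn R); apply.
Unshelve. all: by end_near. Qed.

Lemma excess_wbox_ratio s s' (u : 'rV[rat]_s) (v : 'rV[rat]_s') :
    (0 < s)%N -> (forall t, 0 < u 0 t) -> (forall t, 0 < v 0 t) ->
    (common_den v %| common_den u)%N ->
  excess R (wbox v n) / excess R (wbox u n) @[n --> wtdiam_filter u] -->
  (ratr (weight v / weight u) : R).
Proof.
move=> s0 u0 v0 vu; have FF := wtdiam_filter_proper u.
have FF' : Filter (wtdiam_filter u) by exact: filter_filter.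
have W0 : 0 < ratr (weight u) :> R by rewrite ltr0q weight_gt0.
have inv0 : (n%:R : R)^-1 @[n --> wtdiam_filter u] --> (0 : R).
  apply: (@cvg_trans _ ((n%:R : R)^-1 @[n --> \oo])); last exact: cvg_natr_inv.
  by apply: cvg_app; exact: wtdiam_filter_infty.
have lin (a b : R) : a - b * n%:R^-1 @[n --> wtdiam_filter u] --> a - b * 0.
  by apply: cvgB; [exact: cvg_cst | exact: cvgMl_tmp].
have H : (ratr (weight v) - s'%:R * n%:R^-1) * (ratr (weight u) - s%:R * n%:R^-1)^-1
    @[n --> wtdiam_filter u] -->
    ((ratr (weight v) - s'%:R * 0) * (ratr (weight u) - s%:R * 0)^-1 : R).
  apply: cvgM; first exact: lin.
  by apply: cvgV; [rewrite mulr0 subr0 gt_eqF | exact: lin].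
rewrite !mulr0 !subr0 -fmorph_div in H.
apply: cvg_trans H; apply: near_eq_cvg; near=> n.
have un : (common_den u %| n)%N by near: n; exact: withinT.
have n0 : (0 < n)%N by near: n; apply: wtdiam_filter_infty; exact: nbhs_infty_gt.
have nn0 : n%:R != 0 :> R by rewrite pnatr_eq0 -lt0n.
rewrite !excess_wbox ?(dvdn_trans vu) //.
have E (a : R) b : a * n%:R - b = (a - b * n%:R^-1) * n%:R by rewrite mulrBl divfK.
by rewrite !E -mulf_div divff // mulr1.
Unshelve. all: by end_near. Qed.

Lemma wtdiam_seqE s c (L : set 'rV[Cplx R]_s) (u : 'rV[rat]_s) :
    bounded_by c L -> (s = 0%N -> L !=set0) -> (forall t, 0 < u 0 t) ->
  \forall n \near wtdiam_filter u, wtdiam_seq u L n = cdiam L (wbox u n).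
Proof.
move=> Lc L0 u0; have FF := wtdiam_filter_proper u.
near=> n; have n2 : forall t, (2 <= wbox u n t)%N by near: n; exact: wbox_ge2.
by rewrite /wtdiam_seq det_degree_vdetE // (sup_vandermondeE Lc).
Unshelve. all: by end_near. Qed.

End WeightedBoxes.

(* C^r is C^(k + l), so that l stands for r - k. C^0 is a point; as a factor of
   a product it must not be replaced by its empty subset. *)
Theorem theorem6p1 (R : realType) (k l : nat)
    (K1 : set 'rV[Cplx R]_k) (K2 : set 'rV[Cplx R]_l)
    (cK1 : compact K1) (cK2 : compact K2)
    (K1pt : k = 0%N -> K1 !=set0) (K2pt : l = 0%N -> K2 !=set0) :
  (forall w : 'rV[rat]_(k + l),
     (forall t, 0 < w 0 t) ->
     wtdiam_exists w (prod_set K1 K2) ->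
     wtdiam_exists (lsubmx w) K1 ->
     wtdiam_exists (rsubmx w) K2 ->
     wtdiam w (prod_set K1 K2) =
       wtdiam (lsubmx w) K1 `^ ratr (weight (lsubmx w) / weight w) *
       wtdiam (rsubmx w) K2 `^ ratr (weight (rsubmx w) / weight w)) /\
  tdiam (prod_set K1 K2) =
    tdiam K1 `^ (k%:R / (k + l)%:R) * tdiam K2 `^ (l%:R / (k + l)%:R).
Proof.
have [c [bK1 bK2]] : exists c, bounded_by c K1 /\ bounded_by c K2.
  have [c1 [c11 b1]] := compact_bounded_by cK1.
  have [c2 [c21 b2]] := compact_bounded_by cK2.
  exists (Num.max c1 c2); split; split; rewrite ?le_max ?c11 ?c21 ?orbT //.
    by move=> z /b1 zc t; rewrite le_max zc.
  by move=> z /b2 zc t; rewrite le_max zc orbT.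
have bK := prod_set_bounded bK1 bK2.
have Kpt : (k + l)%N = 0%N -> prod_set K1 K2 !=set0.
  move=> /eqP; rewrite addn_eq0 => /andP[/eqP/K1pt[z1 Kz1] /eqP/K2pt[z2 Kz2]].
  by exists (row_mx z1 z2); split; rewrite ?row_mxKl ?row_mxKr.
have cdiam0 s (L : set 'rV[Cplx R]_s) N : s = 0%N -> L !=set0 -> cdiam L N = 1.
  by move=> s0; subst s => Lpt; rewrite /cdiam vmax_dim0 // powR1.
split=> [w w0 _ ex1 ex2|].
  have wl0 t : 0 < lsubmx w 0 t by rewrite mxE.
  have wr0 t : 0 < rsubmx w 0 t by rewrite mxE.
  have FF := wtdiam_filter_proper w.
  have lim_of s (L : set 'rV[Cplx R]_s) (u : 'rV[rat]_s) :
      bounded_by c L -> (s = 0%N -> L !=set0) -> (forall t, 0 < u 0 t) ->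
      wtdiam_exists u L -> (common_den u %| common_den w)%N ->
      cdiam L (wbox u n) @[n --> wtdiam_filter w] --> wtdiam u L.
    move=> bL Lpt u0 exL uw.
    have FFu : Filter (wtdiam_filter u) by apply: filter_filter; exact: wtdiam_filter_proper.
    apply: (@cvg_trans _ (cdiam L (wbox u n) @[n --> wtdiam_filter u])).
      by apply: cvg_app; exact: wtdiam_filter_sub.
    apply: cvg_trans exL; apply: near_eq_cvg; exact: wtdiam_seqE bL Lpt u0.
  have d1 := lim_of _ _ _ bK1 K1pt wl0 ex1 (common_den_lsubmx w).
  have d2 := lim_of _ _ _ bK2 K2pt wr0 ex2 (common_den_rsubmx w).
  apply: cvg_lim; first exact: Rhausdorff.
  have FF' : Filter (wtdiam_filter w) by exact: filter_filter.
  apply: (@cvg_trans _ (cdiam (prod_set K1 K2) (wbox w n) @[n --> wtdiam_filter w])).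
    by apply: near_eq_cvg; have := wtdiam_seqE bK Kpt w0; apply: filterS => n ->.
  have [kl0|kl0] := posnP (k + l).
    have k0 : k = 0%N by move/eqP: kl0; rewrite addn_eq0 => /andP[/eqP].
    have l0 : l = 0%N by move/eqP: kl0; rewrite addn_eq0 => /andP[_ /eqP].
    have -> : weight (lsubmx w) = 0.
      by rewrite /weight big1 // => t; have := ltn_ord t; rewrite {2}k0.
    have -> : weight (rsubmx w) = 0.
      by rewrite /weight big1 // => t; have := ltn_ord t; rewrite {2}l0.
    rewrite !mul0r rmorph0 !powRr0 mulr1; apply: cvg_near_cst; apply: nearW => n.
    exact: cdiam0 (Kpt kl0).
  have ratio_gt0 s (u : 'rV[rat]_s) : (forall t, 0 < u 0 t) -> (0 < s)%N ->
      0 < ratr (weight u / weight w) :> R.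
    by move=> u0 s0; rewrite ltr0q divr_gt0 // weight_gt0.
  have wl n : (fun t => wbox w n (lshift l t)) = wbox (lsubmx w) n.
    by apply/funext => t; rewrite /wbox mxE.
  have wr n : (fun t => wbox w n (rshift k t)) = wbox (rsubmx w) n.
    by apply/funext => t; rewrite /wbox mxE.
  have rl := excess_wbox_ratio kl0 w0 wl0 (common_den_lsubmx w).
  have rr := excess_wbox_ratio kl0 w0 wr0 (common_den_rsubmx w).
  apply: (cdiam_prod_cvg bK1 bK2 K1pt K2pt kl0 FF (Nf := wbox w)).
  - exact: wbox_ge2.
  - exact: excess_wbox_cvg.
  - by under eq_fun do rewrite wl; exact: rl.
  - by under eq_fun do rewrite wr; exact: rr.
  - exact: ratio_gt0.
  - exact: ratio_gt0.
  - by under eq_fun do rewrite wl; exact: d1.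
  - by under eq_fun do rewrite wr; exact: d2.
have lim_of s (L : set 'rV[Cplx R]_s) : bounded_by c L -> (s = 0%N -> L !=set0) ->
    cdiam L (fun _ : 'I_s => n) @[n --> \oo] --> tdiam L.
  move=> bL Lpt; apply: cvg_trans (tdiam_seq_cvg bL Lpt); apply: near_eq_cvg; near=> n.
  by rewrite (tdiam_seqE bL) //; near: n; exact: nbhs_infty_ge.
have d1 := lim_of _ _ bK1 K1pt; have d2 := lim_of _ _ bK2 K2pt.
have d := lim_of _ _ bK Kpt.
apply: (norm_cvg_unique d).
have [kl0|kl0] := posnP (k + l).
  have -> : (k + l)%:R = 0 :> R by rewrite kl0.
  rewrite invr0 !mulr0 !powRr0 mulr1; apply: cvg_near_cst; apply: nearW => n.
  exact: cdiam0 (Kpt kl0).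
have ratio s : excess R (fun _ : 'I_s => n) / excess R (fun _ : 'I_(k + l) => n)
    @[n --> \oo] --> (s%:R / (k + l)%:R : R).
  apply: cvg_near_cst; near=> n; rewrite !excess_cube -mulf_div divff ?mulr1 //.
  by rewrite gt_eqF // subr_gt0 ltr1n; near: n; exact: nbhs_infty_gt.
apply: (cdiam_prod_cvg bK1 bK2 K1pt K2pt kl0 _ (Nf := fun n _ => n)) => //.
- by near=> n => t; near: n; exact: nbhs_infty_ge.
- have -> : (fun n => excess R (fun _ : 'I_(k + l) => n)) = (fun n => (k + l)%:R * (n%:R - 1)).
    by apply/funext => n; exact: excess_cube.
  apply/cvgryPge => A; near=> n; rewrite mulrC -ler_pdivrMr ?ltr0n //.
  by near: n; move/cvgryPge: (@cvg_natr_subr1 R); apply.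
- by move=> k0; rewrite divr_gt0 ?ltr0n.
- by move=> l0; rewrite divr_gt0 ?ltr0n.
Unshelve. all: by end_near. Qed.
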